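(* Let $\mathcal{M}=\langle S,A,\mathcal{R},\mathcal{P},\mu,\gamma\rangle$ be an MDP, let $\pi_*:S\to\Delta(A)$ be any (target) policy, and let $d^{\mathrm{off}}\in\Delta(S)$ satisfy $d^{\pi_*}(s)>0\Rightarrow d^{\mathrm{off}}(s)>0$. Let $\phi:S\to Z$ be a representation function and let $\mathcal{R}_Z:Z\times A\to[-R_{\max},R_{\max}]$ and $\mathcal{P}_Z:Z\times A\to\Delta(S)$ be models. Define $$\epsilon_{\mathrm{R},\mathrm{T}}:=\frac{|A|}{1-\gamma}J_{\mathrm{R}}(\mathcal{R}_Z,\phi)+\frac{2\gamma|A|R_{\max}}{(1-\gamma)^2}J_{\mathrm{T}}(\mathcal{P}_Z,\phi).$$ Then for every latent policy $\pi_Z:Z\to\Delta(A)$, $$\mathrm{PerfDiff}(\pi_Z,\pi_* )\le\left(1+D_{\chi^2}(d^{\pi_*}\|d^{\mathrm{off}})^{1/2}\right)\epsilon_{\mathrm{R},\mathrm{T}}+C\sqrt{\tfrac12\,\mathbb{E}_{z\sim d^{\pi_*}_Z}\left[D_{\mathrm{KL}}(\pi_{*,Z}(z)\|\pi_Z(z))\right]},$$ where $C=\frac{2R_{\max}}{(1-\gamma)^2}$ and $$d^{\pi_*}_Z(z):=\Pr[z=\phi(s)\mid s\sim d^{\pi_*}],\qquad \pi_{*,Z}(z):=\mathbb{E}[\pi_*(s)\mid s\sim d^{\pi_*},\,z=\phi(s)].$$ Moreover $\mathbb{E}_{z\sim d^{\pi_*}_Z}[D_{\mathrm{KL}}(\pi_{*,Z}(z)\|\pi_Z(z))]=\mathrm{const}(\pi_*,\phi)+J_{\mathrm{BC},\phi}(\pi_Z)$,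 where $\mathrm{const}(\pi_*,\phi)$ depends only on $\pi_*$ and $\phi$ (and the MDP), not on $\pi_Z$.
   Context: MDP: $S$ is the state space (treated as discrete, with distributions given by probability mass functions), $A$ is a finite action space, $\mathcal{R}:S\times A\to[-R_{\max},R_{\max}]$ is the reward function, $\mathcal{P}:S\times A\to\Delta(S)$ is the transition function, $\mu\in\Delta(S)$ is the initial state distribution, $\gamma\in[0,1)$ is the discount. $\Delta(X)$ is the set of probability distributions on $X$. A policy is $\pi:S\to\Delta(A)$; it generates $s_0\sim\mu$, $a_t\sim\pi(s_t)$, $s_{t+1}\sim\mathcal{P}(s_t,a_t)$. Its performance is $J_{\mathrm{Perf}}(\pi)=\mathbb{E}[\sum_{t\ge0}\gamma^t\mathcal{R}(s_t,a_t)\mid\pi,\mathcal{M}]$, and its visitation distribution is $d^\pi(s)=(1-\gamma)\sum_{t\ge0}\gamma^t\Pr[s_t=s\mid\pi,\mathcal{M}]$. $\mathrm{PerfDiff}(\pi,\pi_* )=|J_{\mathrm{Perf}}(\pi)-J_{\mathrm{Perf}}(\pi_* )|$, and for a latent policy $\pi_Z:Z\to\Delta(A)$, $\mathrm{PerfDiff}(\pi_Z,\pi_* )$ means $\mathrm{PerfDiff}(\pi_Z\circ\phi,\pi_* )$, evaluated in $\mathcal{M}$. Representation losses: $J_{\mathrm{R}}(\mathcal{R}_Z,\phi)\ge0$ and $J_{\mathrm{T}}(\mathcal{P}_Z,\phi)\ge0$ are defined by $J_{\mathrm{R}}(\mathcal{R}_Z,\phi)^2=\mathbb{E}_{s\sim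 d^{\mathrm{off}},a\sim\mathrm{Unif}_A}[(\mathcal{R}(s,a)-\mathcal{R}_Z(\phi(s),a))^2]$ and $J_{\mathrm{T}}(\mathcal{P}_Z,\phi)^2=\frac12\mathbb{E}_{s\sim d^{\mathrm{off}},a\sim\mathrm{Unif}_A}[D_{\mathrm{KL}}(\mathcal{P}(s,a)\|\mathcal{P}_Z(\phi(s),a))]$, where $\mathrm{Unif}_A$ is the uniform distribution on $A$. Behavioral cloning loss: $J_{\mathrm{BC},\phi}(\pi_Z)=\mathbb{E}_{s\sim d^{\pi_*},a\sim\pi_*(s)}[-\log\pi_Z(a|\phi(s))]$. $D_{\mathrm{KL}}$ is the Kullback–Leibler divergence and $D_{\chi^2}(p\|q)=\sum_s (p(s)-q(s))^2/q(s)$ is the Pearson $\chi^2$ divergence. *)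

(* Defs.v *)
From HB Require Import structures.
From mathcomp Require Import all_boot all_order all_algebra finmap.
From mathcomp Require Import all_classical all_reals all_analysis.
From mathcomp Require Import lra.
Set Implicit Arguments.
Unset Strict Implicit.
Unset Printing Implicit Defensive.
Import Order.TTheory GRing.Theory Num.Theory.
Import numFieldNormedType.Exports.
Local Open Scope classical_set_scope.
Local Open Scope ring_scope.

(* A probability mass function on a discrete type; summability makes its support
   countable. *)
Record distr (R : realType) (X : choiceType) := Distr {
  distr_val :> X -> R;
  distr_ge0 : forall x, 0 <= distr_val x;
  distr_sum1 : (\esum_(x in [set: X]) (distr_val x)%:E = 1)%E }.

Section distr.
Context (R : realType) (T : choiceType) (p : distr R T).

Lemma le_esum_subset (A B : set T) : (forall x, A x -> 0 < p x -> B x) ->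
  (\esum_(x in A) (p x)%:E <= \esum_(x in B) (p x)%:E)%E.
Proof.
move=> AB; rewrite esum_mkcond [leRHS]esum_mkcond; apply: le_esum => x _.
case: ifPn => [|_]; last by case: ifP => //; rewrite lee_fin distr_ge0.
rewrite inE => Ax; have := distr_ge0 p x; rewrite le_eqVlt => /predU1P[<-|px].
  by case: ifP.
by rewrite ifT// inE; exact: AB.
Qed.

Lemma esum_distr_le1 (A : set T) : (\esum_(x in A) (p x)%:E <= 1)%E.
Proof. by rewrite -(distr_sum1 p); exact: le_esum_subset. Qed.

Lemma esum_distr_fin (A : set T) : (\esum_(x in A) (p x)%:E)%E \is a fin_num.
Proof.
rewrite ge0_fin_numE; last by apply: esum_ge0 => x _; rewrite lee_fin distr_ge0.
exact: le_lt_trans (esum_distr_le1 A) (ltry _).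
Qed.

Lemma esum_distr_fset (F : {fset T}) :
  (\esum_(x in [set` F]) (p x)%:E = (\sum_(x <- F) p x)%:E)%E.
Proof.
rewrite esum_fset//; last by move=> x _; rewrite lee_fin distr_ge0.
by rewrite fsbig_finite//= set_fsetK sumEFin.
Qed.

Lemma distr_countable : countable [set x | 0 < p x].
Proof.
have -> : [set x | 0 < p x] = \bigcup_n [set x | n.+1%:R^-1 <= p x].
  apply/seteqP; split=> [x /= px|x [n _ /=]]; last first.
    by apply: lt_le_trans; rewrite invr_gt0.
  exists (Num.truncn (p x)^-1) => //=.
  rewrite invf_ple ?posrE// ltW//.
  exact: truncnS_gt.
apply: bigcup_countable => // n _.
apply: finite_set_countable; apply: contrapT => /infinite_set_fset.
move=> /(_ n.+2)[F Fp nF].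
have := esum_distr_le1 [set` F]; rewrite esum_distr_fset lee_fin.
apply/negP; rewrite -ltNge.
apply: (@lt_le_trans _ _ (\sum_(x <- F) n.+1%:R^-1)).
  rewrite big_const_seq count_predT iter_addr_0 -[ltRHS]mulr_natr.
  by rewrite ltr_pdivlMl// mulr1 ltr_nat.
rewrite big_seq [leRHS]big_seq; apply: ler_sum => x xF.
exact: Fp.
Qed.

(* [0, 1[ is partitioned into intervals [L x, L x + p x[. *)
Lemma distr_intervals : exists L : T -> R,
  [/\ forall x, 0 <= L x /\ L x + p x <= 1,
      forall u, 0 <= u < 1 -> exists x, L x <= u < L x + p x &
      forall u x y, L x <= u < L x + p x -> L y <= u < L y + p y -> x = y].
Proof.
have /countable_injP[g ginj] := distr_countable.
pose D n := [set x | 0 < p x /\ (g x < n)%N].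
pose G n := fine (\esum_(x in D n) (p x)%:E)%E.
have GE n : (\esum_(x in D n) (p x)%:E = (G n)%:E)%E.
  by rewrite fineK// esum_distr_fin.
have G0 n : 0 <= G n.
  by rewrite -lee_fin -GE; apply: esum_ge0 => x _; rewrite lee_fin distr_ge0.
have G1 n : G n <= 1 by rewrite -lee_fin -GE esum_distr_le1.
have Gle m n : (m <= n)%N -> G m <= G n.
  move=> mn; rewrite -lee_fin -!GE; apply: le_esum_subset => x [px gx] _.
  by split => //; exact: leq_trans mn.
have GS x : 0 < p x -> G (g x).+1 = G (g x) + p x.
  move=> px; apply: EFin_inj; rewrite EFinD -!GE.
  rewrite (esumID (D (g x))); last by move=> i _; rewrite lee_fin distr_ge0.
  congr (_ + _)%E.
    congr esum; apply/seteqP; split=> [y []//|y [py yx]]; split=> //.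
    by split=> //; exact: leqW.
  rewrite -[RHS](@esum_set1 _ _ x (fun x => (p x)%:E)); last first.
    by rewrite lee_fin distr_ge0.
  congr esum; apply/seteqP; split=> [y [[py yx]] nD|y ->] /=.
    apply: ginj; rewrite ?inE//; apply/eqP; rewrite eqn_leq -ltnS yx/= leqNgt.
    by apply/negP => xy; apply: nD.
  by split=> // -[_]; rewrite ltnn.
exists (G \o g); split.
- move=> x; split; first exact: G0.
  have := distr_ge0 p x; rewrite le_eqVlt => /predU1P[<-|px] /=.
    by rewrite addr0.
  by rewrite -GS.
- move=> u /andP[u0 u1].
  have [n un] : exists n, u < G n.
    have : (u%:E < \esum_(x in [set: T]) (p x)%:E)%E.
      by rewrite distr_sum1 lte_fin.
    move=> /ereal_sup_gt[_ [F [finF _] <-]] uF.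
    exists (\max_(x <- fset_set F) g x).+1; rewrite -lte_fin -GE.
    apply: (lt_le_trans uF).
    rewrite -esum_fset//; last by move=> x _; rewrite lee_fin distr_ge0.
    apply: le_esum_subset => x Fx px; split=> //; rewrite ltnS.
    have xF : x \in fset_set F by rewrite in_fset_set// inE.
    by rewrite (big_rem x)//= leq_maxl.
  case: (@ex_minnP (fun n => u < G n)); first by exists n.
  case=> [|m] um mmin.
    move: um; rewrite -lte_fin -GE (_ : D 0%N = set0) ?esum_set0.
      by rewrite lte_fin ltNge u0.
    by apply/seteqP; split=> // x [].
  have Gm : G m <= u by rewrite leNgt; apply/negP => /mmin; rewrite ltnn.
  have [x [px gx]] : exists x, 0 < p x /\ g x = m.
    apply: contrapT => nx; have := le_lt_trans Gm um; apply/negP; rewrite -leNgt.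
    rewrite -lee_fin -!GE; apply: le_esum_subset => x [px].
    rewrite ltnS leq_eqVlt => /predU1P[gx|gx] _; last by [].
    by exfalso; apply: nx; exists x.
  by exists x => /=; rewrite -GS// gx Gm.
- have wl u x y : G (g x) <= u < G (g x) + p x -> G (g y) <= u < G (g y) + p y ->
      (g x < g y)%N -> False.
    move=> /andP[xu ux] /andP[yu uy] xy.
    have px : 0 < p x by rewrite -(ltrD2l (G (g x))) addr0; exact: le_lt_trans ux.
    by move: ux; rewrite -GS// ltNge (le_trans _ yu)// Gle.
  move=> u x y /= xu yu.
  have pos z : G (g z) <= u < G (g z) + p z -> 0 < p z.
    move=> /andP[zu uz]; rewrite -(ltrD2l (G (g z))) addr0; exact: le_lt_trans uz.
  case: (ltngtP (g x) (g y)) => [/(wl _ _ _ xu yu)//|/(wl _ _ _ yu xu)//|].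
  by apply: ginj; rewrite inE; apply: pos.
Qed.

End distr.

Lemma distr_inhabited (R : realType) (T : choiceType) (p : distr R T) :
  exists x : T, 0 < p x.
Proof.
apply: contrapT => np; have := distr_sum1 p.
rewrite esum1; first by move=> /eqP; rewrite lt_eqF.
move=> x _; congr EFin; apply: le_anti; rewrite distr_ge0 andbT leNgt.
by apply/negP => px; apply: np; exists x.
Qed.

Lemma countable_bigcup_measurable d (U : measurableType d) (T : Type)
    (H : set T) (F : T -> set U) : countable H ->
  (forall h, measurable (F h)) -> measurable (\bigcup_(h in H) F h).
Proof.
move=> /countable_injP[f finj] mF.
have -> : \bigcup_(h in H) F h = \bigcup_n
    (if pselect (exists h, H h /\ f h = n) is left e then F (projT1 (cid e)) else set0).
  apply/seteqP; split=> [u [h Hh Fu]|u [n _]].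
    exists (f h) => //; case: pselect => [e|[]]; last by exists h.
    case: cid => h' /= [Hh' ff]; rewrite (_ : h' = h)//.
    by apply: finj => //; rewrite inE.
  by case: pselect => // e; case: cid => h' /= [Hh' _] Fu; exists h'.
apply: bigcupT_measurable => n; case: pselect => // e; exact: mF.
Qed.

Section chain.
Context (R : realType) (T : choiceType) (k : T -> distr R T).
Implicit Types (p : distr R T) (u : R) (h : seq T).

Fixpoint chain_weight (p : T -> R) h : R :=
  if h is x :: h' then p x * chain_weight (k x) h' else 1.

Let left p : T -> R := projT1 (cid (distr_intervals p)).
Let code p u : T := xget (projT1 (cid (distr_inhabited p)))
  [set x | left p x <= u < left p x + p x].
Let rest p u : R := (u - left p (code p u)) / p (code p u).
Let path := fix path t p u : T :=
  if t is t'.+1 then path t' (k (code p u)) (rest p u) else code p u.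

Let codeE p u x : 0 <= u < 1 ->
  code p u = x <-> left p x <= u < left p x + p x.
Proof.
rewrite /code /left => u01; case: (cid (distr_intervals p)) => L /= [L01 Lex Luniq]; split=> [<-|xu].
  have [y yu] := Lex _ u01.
  exact: (@xgetPex _ _ [set x | L x <= u < L x + p x]) (ex_intro _ y yu).
by case: xgetP => [y -> /= yu|/(_ x)//]; exact: Luniq yu xu.
Qed.

Let left01 p x : 0 <= left p x /\ left p x + p x <= 1.
Proof. by rewrite /left; case: (cid (distr_intervals p)) => L /= []. Qed.

Let rest01 p u : 0 <= u < 1 -> 0 <= rest p u < 1.
Proof.
move=> u01; have /andP[] := (codeE p (code p u) u01).1 erefl.
rewrite /rest; set x := code p u => xu ux.
have px : 0 < p x by lra.
rewrite divr_ge0 ?subr_ge0 ?distr_ge0//=.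
by rewrite ltr_pdivrMr// mul1r ltrBlDl.
Qed.

Let mkseq_path p u n : mkseq (fun t => path t p u) n.+1 =
  code p u :: mkseq (fun t => path t (k (code p u)) (rest p u)) n.
Proof. by rewrite /mkseq /= (iotaDl 1 0) -map_comp. Qed.

Let weight_ge0 p h : 0 <= chain_weight p h.
Proof. by elim: h p => //= x h ih p; rewrite mulr_ge0 ?distr_ge0. Qed.

Let path_interval p h : exists a, [/\ 0 <= a, a + chain_weight p h <= 1 &
  forall u, 0 <= u < 1 ->
    mkseq (fun t => path t p u) (size h) = h <-> a <= u < a + chain_weight p h].
Proof.
elim: h p => [p|x h ih p].
  by exists 0; split=> //=; rewrite ?add0r.
have [a [a0 a1 ah]] := ih (k x); have [l0 l1] := left01 p x.
have px := distr_ge0 p x; have w0 := weight_ge0 (k x) h.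
exists (left p x + p x * a) => /=; split.
- by rewrite addr_ge0// mulr_ge0.
- rewrite -addrA -mulrDr; apply: le_trans l1; rewrite lerD2l.
  by rewrite -[leRHS]mulr1 ler_wpM2l.
move=> u u01; rewrite mkseq_path.
move: px; rewrite le_eqVlt => /predU1P[px|px].
  split; last by rewrite -px !mul0r !addr0 => /andP[/le_lt_trans/[apply]]; rewrite ltxx.
  by move=> [/(codeE p x u01).1]; rewrite -px addr0 => /andP[/le_lt_trans/[apply]]; rewrite ltxx.
have aux : left p x + p x * a <= u < left p x + p x * a + p x * chain_weight (k x) h <->
    a <= (u - left p x) / p x < a + chain_weight (k x) h.
  by rewrite ler_pdivlMr// ltr_pdivrMr// lerBrDl ltrBlDl -addrA -mulrDr ![_ * p x]mulrC.
split=> [[cx]|/aux aw].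
  rewrite cx => hh; apply/aux; have := rest01 p u01; rewrite /rest cx => r01.
  by apply/(ah _ r01); move: hh; rewrite /rest cx.
have cx : code p u = x.
  apply/(codeE p x u01); move: aw => /andP[+ aw].
  rewrite ler_pdivlMr// => aw'; move: aw; rewrite ltr_pdivrMr// => aw.
  have pa : 0 <= a * p x by rewrite mulr_ge0// ltW.
  have : (a + chain_weight (k x) h) * p x <= p x.
    by rewrite -[leRHS]mul1r ler_wpM2r// ltW.
  by move=> ?; apply/andP; split; lra.
have := rest01 p u01; rewrite /rest cx => r01; congr cons.
by apply/(ah _ r01).
Qed.

Let weight_countable p n :
  countable [set h | size h = n /\ 0 < chain_weight p h].
Proof.
elim: n p => [p|n ih p].
  apply: (@sub_countable _ _ _ [set [::]]); last exact: countable1.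
  by apply: subset_card_le => h /= [/size0nil].
apply: (@sub_countable _ _ _ (\bigcup_(x in [set x | 0 < p x])
    (cons x @` [set h | size h = n /\ 0 < chain_weight (k x) h]))).
  apply: subset_card_le => -[|x h] /= [] // [hn] ph.
  have px : 0 < p x.
    rewrite lt_neqAle distr_ge0 andbT; apply/eqP => px.
    by move: ph; rewrite -px mul0r ltxx.
  by exists x => //; exists h => //; split=> //; rewrite -(pmulr_rgt0 _ px).
apply: bigcup_countable; first exact: distr_countable.
by move=> x _; apply: sub_countable (card_image_le _ _) (ih _).
Qed.

(* Every chain with initial law p and transition law k is realized over the
   uniform probability on the unit interval, by iterated interval splitting: the
   points whose first steps are h form an interval of length chain_weight p h. *)
Theorem chain_exists p : exists X : nat -> measurableTypeR R -> T,
  (forall t B, measurable (X t @^-1` B)) /\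
  (forall h, uniform_prob (@ltr01 R) [set u | mkseq (X ^~ u) (size h) = h] =
     (chain_weight p h)%:E).
Proof.
have [x0 _] := distr_inhabited p.
pose X t (u : measurableTypeR R) := if 0 <= u < 1 then path t p u else x0.
have mI (a b : R) : measurable ([set u | a <= u < b] : set (measurableTypeR R)).
  have -> : [set u | a <= u < b] = `[a, b[%classic by apply/seteqP; split=> u /=; rewrite in_itv.
  exact: measurable_itv.
have XE u h : 0 <= u < 1 -> mkseq (X ^~ u) (size h) = mkseq (fun t => path t p u) (size h).
  by move=> u01; apply: eq_map => t; rewrite /X u01.
have mX t B : measurable (X t @^-1` B).
  pose H := [set h | (size h = t.+1 /\ 0 < chain_weight p h) /\ B (last x0 h)].
  have -> : X t @^-1` B = (\bigcup_(h in H) ([set u | 0 <= u < 1] `&`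
        [set u | projT1 (cid (path_interval p h)) <= u <
                 projT1 (cid (path_interval p h)) + chain_weight p h])) `|`
      (~` [set u | 0 <= u < 1] `&` [set _ | B x0]).
    apply/seteqP; split=> [u /= BXu|u].
      case u01 : (0 <= u < 1); last first.
        by right; split=> //=; move: BXu; rewrite /X u01.
      left; pose h := mkseq (fun t => path t p u) t.+1.
      have sh : size h = t.+1 by rewrite size_mkseq.
      have uh : mkseq (fun t => path t p u) (size h) = h by rewrite sh.
      exists h; last by split=> //=; case: cid => a /= [_ _] /(_ _ u01) [+ _]; exact.
      split; last first.
        by rewrite (last_nth x0) sh /= nth_mkseq//; move: BXu; rewrite /X u01.
      split=> //; have [a [_ _ /(_ _ u01) [/(_ uh)]]] := path_interval p h.
      by move=> /andP[? ?] _; lra.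
    move=> [[h [[sh ph] Bh] [/= u01]]|[/= /negP/negbTE u01]]; last by rewrite /X u01.
    case: cid => a /= [_ _ /(_ _ u01) [_ H1]] /H1 uh.
    by rewrite /X u01; move: Bh; rewrite -uh sh (last_nth x0) size_mkseq /= nth_mkseq.
  apply: measurableU; last first.
    apply: measurableI; first by apply: measurableC; exact: mI.
    have [Bx0|Bx0] := pselect (B x0).
      by rewrite (_ : [set _ | _] = setT)//; apply/seteqP; split.
    by rewrite (_ : [set _ | _] = set0)//; apply/seteqP; split.
  apply: countable_bigcup_measurable => [|h]; last by apply: measurableI; exact: mI.
  apply: (@sub_countable _ _ _ [set h | size h = t.+1 /\ 0 < chain_weight p h]).
    by apply: subset_card_le => h [].
  exact: weight_countable.
exists X; split=> // h.
have [a [a0 a1 ah]] := path_interval p h.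
have w0 := weight_ge0 p h.
have PI (b c : R) : 0 <= b -> b <= c -> c <= 1 ->
    uniform_prob (@ltr01 R) [set u | b <= u < c] = (c - b)%:E.
  move=> b0 bc c1; rewrite /uniform_prob integral_uniform_pdf.
  rewrite (_ : _ `&` _ = `[b, c[%classic); last first.
    apply/seteqP; split=> [u []//|u /=]; rewrite !in_itv/= => bu; split=> //.
    by move: bu => /andP[? ?]; lra.
  rewrite (eq_integral (cst 1%E)) ?integral_cst//=.
    rewrite mul1e lebesgue_measure_itv/= lte_fin.
    case: ltP => // cb; rewrite (_ : c = b) ?subrr//; exact/le_anti/andP.
  move=> u; rewrite inE/= in_itv/= => bu; rewrite /uniform_pdf ifT ?subr0 ?invr1//.
  by move: bu => /andP[? ?]; lra.
pose J : set (measurableTypeR R) := [set u | 0 <= u < 1].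
have mJ : measurable J by exact: mI.
have PJC : uniform_prob (@ltr01 R) (~` J) = 0%E.
  transitivity (1 - uniform_prob (@ltr01 R) J)%E; first exact: probability_setC.
  by rewrite /J PI// subr0 subee.
pose N := [set _ : measurableTypeR R | nseq (size h) x0 = h] `&` ~` J.
have mN : measurable N.
  apply: measurableI; last exact: measurableC.
  have [Bx0|Bx0] := pselect (nseq (size h) x0 = h).
    by rewrite (_ : [set _ | _] = setT)//; apply/seteqP; split.
  by rewrite (_ : [set _ | _] = set0)//; apply/seteqP; split.
have PN : uniform_prob (@ltr01 R) N = 0%E.
  apply/eqP; rewrite eq_le measure_ge0 andbT -PJC.
  apply: le_measure; rewrite ?inE//; first [exact: measurableC|by move=> u []].
rewrite (_ : [set u | _] = [set u | a <= u < a + chain_weight p h] `|` N).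
  have IN0 : [set u | a <= u < a + chain_weight p h] `&` N = set0.
    apply/seteqP; split=> // u [/= /andP[au uw] [_ /= nJ]]; apply: nJ.
    by rewrite /J/=; lra.
  transitivity (uniform_prob (@ltr01 R) [set u | (a <= u < a + chain_weight p h)%R] +
      uniform_prob (@ltr01 R) N)%E.
    exact: (measureU (uniform_prob (@ltr01 R)) (mI _ _) mN IN0).
  by rewrite PI ?lerDl// PN adde0 addrC addKr.
apply/seteqP; split=> u /=.
  case u01 : (0 <= u < 1).
    by rewrite XE// => /(ah _ u01); left.
  move=> hh; right; split; last by rewrite /J/= u01.
  rewrite /= -[RHS]hh; apply: (@eq_from_nth _ x0); rewrite ?size_nseq ?size_mkseq//.
  by move=> i ih; rewrite nth_nseq ih nth_mkseq// /X u01.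
move=> [au|[/= hh /negP/negbTE u01]].
  have u01 : 0 <= u < 1 by move: au => /andP[? ?]; lra.
  by rewrite XE//; apply/(ah _ u01).
rewrite -[RHS]hh; apply: (@eq_from_nth _ x0); rewrite ?size_nseq ?size_mkseq//.
by move=> i ih; rewrite nth_nseq ih nth_mkseq// /X u01.
Qed.
End chain.

Record mdp (R : realType) (S : choiceType) (A : finType) := Mdp {
  Rmax : R;
  reward : S -> A -> R;
  reward_bound : forall s a, - Rmax <= reward s a <= Rmax;
  trans : S -> A -> distr R S;
  init : distr R S;
  gamma : R;
  gamma_ge0 : 0 <= gamma;
  gamma_lt1 : gamma < 1 }.

Definition policy (R : realType) (X : choiceType) (A : finType) := X -> distr R A.

(* Probability that the trajectory starts with the state-action pairs h, when the
   first state has law p. *)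
Fixpoint path_prob (R : realType) (S : choiceType) (A : finType)
    (M : mdp R S A) (pi : policy R S A) (p : S -> R) (h : seq (S * A)) : R :=
  if h is (s, a) :: h' then p s * pi s a * path_prob M pi (trans M s a) h' else 1.

(* A process s_0, a_0, s_1, a_1, ... generated by pi in M, on some probability
   space. S and A carry the discrete sigma-algebra. *)
Record trajectory (R : realType) (S : choiceType) (A : finType)
    (M : mdp R S A) (pi : policy R S A) := Trajectory {
  traj_disp : measure_display;
  traj_space : measurableType traj_disp;
  traj_P : probability traj_space R;
  state : nat -> traj_space -> S;
  action : nat -> traj_space -> A;
  state_measurable : forall t (B : set S), measurable (state t @^-1` B);
  action_measurable : forall t (B : set A), measurable (action t @^-1` B);
  traj_law : forall h : seq (S * A),
    traj_P [set w | mkseq (fun t => (state t w, action t w)) (size h) = h] =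
    (path_prob M pi (init M) h)%:E }.

Arguments state {R S A M pi} _ _ _.
Arguments action {R S A M pi} _ _ _.

Section trajectory_exists.
Context (R : realType) (S : choiceType) (A : finType).

Lemma distr_pair_sum1 (p : distr R S) (q : policy R S A) :
  (\esum_(x in [set: S * A]) (p x.1 * q x.1 x.2)%:E = 1)%E.
Proof.
have -> : [set: S * A] = [set: S] `*`` (fun=> [set: A]).
  by apply/seteqP; split.
rewrite -(@esum_esum _ _ _ _ _ (fun s a => (p s * q s a)%:E)); last first.
  by move=> s a _ _; rewrite lee_fin mulr_ge0 ?distr_ge0.
rewrite -(distr_sum1 p); apply: eq_esum => s _.
have finA : finite_set [set: A] by exact: finite_finset.
have qA : \sum_(a <- fset_set [set: A]) q s a = 1.
  apply: EFin_inj; rewrite -sumEFin -[RHS](distr_sum1 (q s)) esum_fset//.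
    by rewrite fsbig_finite.
  by move=> a _; rewrite lee_fin distr_ge0.
rewrite esum_fset//; last by move=> a _; rewrite lee_fin mulr_ge0 ?distr_ge0.
by rewrite fsbig_finite//= sumEFin -mulr_sumr qA mulr1.
Qed.

Definition distr_pair (p : distr R S) (q : policy R S A) : distr R (S * A)%type :=
  @Distr R (S * A)%type (fun x => p x.1 * q x.1 x.2)
    (fun x => mulr_ge0 (distr_ge0 p x.1) (distr_ge0 (q x.1) x.2))
    (distr_pair_sum1 p q).

Theorem trajectory_exists (M : mdp R S A) (pi : policy R S A) :
  inhabited (trajectory M pi).
Proof.
pose k (x : S * A) := distr_pair (trans M x.1 x.2) pi.
have [X [mX PX]] := chain_exists k (distr_pair (init M) pi).
have kE h (p : distr R S) : chain_weight k (distr_pair p pi) h = path_prob M pi p h.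
  by elim: h p => [//|[s a] h ih] p /=; rewrite ih.
constructor; refine (@Trajectory R S A M pi _ _ (uniform_prob (@ltr01 R))
  (fun t u => (X t u).1) (fun t u => (X t u).2) _ _ _).
- by move=> t B; exact: (mX t (fst @^-1` B)).
- by move=> t B; exact: (mX t (snd @^-1` B)).
- move=> h; rewrite -kE -PX; congr (uniform_prob _ _).
  by apply: eq_set => u; congr (_ = _); apply: eq_map => t; rewrite -surjective_pairing.
Qed.

End trajectory_exists.

Section performance.
Context (R : realType) (S : choiceType) (A : finType).
Implicit Types (M : mdp R S A) (pi : policy R S A).

(* All realizations of the process have the same law, so the expectations and
   probabilities below do not depend on which one is picked. *)
Definition traj M pi : trajectory M pi :=
  inhabited_witness (trajectory_exists M pi).

Definition J_perf M pi : \bar R :=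
  'E_(traj_P (traj M pi))[fun w => limn (series (fun t =>
     gamma M ^+ t * reward M (state (traj M pi) t w) (action (traj M pi) t w)))].

Definition visitation M pi (s : S) : R :=
  (1 - gamma M) * limn (series (fun t =>
    gamma M ^+ t * fine (traj_P (traj M pi) (state (traj M pi) t @^-1` [set s])))).

Definition PerfDiff M pi pi' : \bar R := `|J_perf M pi - J_perf M pi'|%E.

End performance.

Section divergences.
Context (R : realType) (X : choiceType).
Local Open Scope ereal_scope.

(* Unconditional sum of a signed family; \esum alone is a supremum of finite sums
   and is meaningful only for nonnegative families. *)
Definition usum (f : X -> \bar R) : \bar R :=
  \esum_(x in [set: X]) f^\+ x - \esum_(x in [set: X]) f^\- x.

(* Since 0 * +oo = 0, points of mass zero do not contribute. *)
Definition expect (p : X -> R) (f : X -> \bar R) : \bar R :=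
  usum (fun x => (p x)%:E * f x).

(* With lne 0 = -oo, a term is 0 if p x = 0, and +oo if p x > 0 = q x. *)
Definition D_KL (p q : X -> R) : \bar R :=
  expect p (fun x => lne (p x)%:E - lne (q x)%:E).

(* With 0^-1 = +oo, a term with q x = 0 is 0 if p x = 0, and +oo otherwise. *)
Definition D_chi2 (p q : X -> R) : \bar R :=
  \esum_(x in [set: X]) ((p x - q x) ^+ 2)%:E / (q x)%:E.

End divergences.

Definition unif (R : realType) (A : finType) (_ : A) : R := #|A|%:R^-1.

Section losses.
Context (R : realType) (S Z : choiceType) (A : finType).
Variables (M : mdp R S A) (phi : S -> Z).
Local Open Scope ereal_scope.

Definition J_R (doff : distr R S) (RZ : Z -> A -> R) : \bar R :=
  sqrte (expect doff (fun s => expect (@unif R A) (fun a =>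
    ((reward M s a - RZ (phi s) a) ^+ 2)%:E))).

Definition J_T (doff : distr R S) (PZ : Z -> A -> distr R S) : \bar R :=
  sqrte (2^-1%:E * expect doff (fun s => expect (@unif R A) (fun a =>
    D_KL (trans M s a) (PZ (phi s) a)))).

Definition eps_RT (doff : distr R S) (RZ : Z -> A -> R)
    (PZ : Z -> A -> distr R S) : \bar R :=
  (#|A|%:R / (1 - gamma M))%:E * J_R doff RZ +
  (2 * gamma M * #|A|%:R * Rmax M / (1 - gamma M) ^+ 2)%:E * J_T doff PZ.

Definition visitationZ (pi : policy R S A) (z : Z) : R :=
  fine (\esum_(s in phi @^-1` [set z]) (visitation M pi s)%:E).

(* Conditional mean of pi s given phi s = z, for s of law visitation M pi;
   identically 0 when visitationZ pi z = 0. *)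
Definition latent_policy (pi : policy R S A) (z : Z) (a : A) : R :=
  fine (\esum_(s in phi @^-1` [set z]) (visitation M pi s * pi s a)%:E) /
  visitationZ pi z.

Definition latent_KL (pi : policy R S A) (piZ : policy R Z A) : \bar R :=
  expect (visitationZ pi) (fun z => D_KL (latent_policy pi z) (piZ z)).

Definition J_BC (pi : policy R S A) (piZ : policy R Z A) : \bar R :=
  expect (visitation M pi) (fun s => expect (pi s) (fun a =>
    - lne (piZ (phi s) a)%:E)).

End losses.

(* Main.v *)
Require Import Defs.
From mathcomp Require Import all_boot all_order all_algebra finmap.
From mathcomp Require Import all_classical all_reals all_analysis measurable_realfun.
From mathcomp Require Import ring lra.
Set Implicit Arguments.
Unset Strict Implicit.
Unset Printing Implicit Defensive.
Import Order.TTheory GRing.Theory Num.Theory.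
Import numFieldNormedType.Exports.
Local Open Scope classical_set_scope.
Local Open Scope ring_scope.

(* Let V be the value function of the latent policy in M, so V = R_pi + g T_pi V.
   Summing g^t (E V(s_t) - g E V(s_{t+1})) along the target policy telescopes, and
   expresses (1 - g) times the difference of the returns as the mean, under the
   visitation distribution d of the target, of
     sum_a (pi_* - pi_Z)(a | s) (R(s, a) + g <P(s, a), V>).
   Replacing R and P by the models costs at most the L1 model errors under d, since
   |pi_* - pi_Z| <= 1; these go to the loss under d^off by Pinsker's inequality and
   by Cauchy-Schwarz in d <= d^off + |d - d^off|.  What remains depends on s only
   through phi s except for pi_*, which may thus be averaged over the fibers of phi;
   Pinsker's inequality on the actions gives the last term.

   The Cauchy-Schwarz and Pinsker inequalities are stated in the extended reals, so
   infinite divergences (including 0 * +oo = 0) need no separate treatment. *)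

(** * Unconditional sums *)

Section esum_extra.
Context (R : realType).
Local Open Scope ereal_scope.

(** Two kinds of sums coexist: [\esum] of nonnegative extended reals, in which every bound that may
    be infinite is stated, and the real [rsum] of summable families, in which the signed algebra
    (linearity, Fubini, telescoping) takes place. The process is known only through the
    probabilities of its finite prefixes on an abstract space, and [S] may be uncountable; its laws
    are therefore first bounded below point by point, and total mass 1 turns these bounds into
    equalities. Constants: [|V| <= Rmax / (1 - g)]; replacing a sum over actions by a uniform mean
    costs [#|A|]; Pinsker's inequality costs 2; dividing by the outer [1 - g] produces the square in
    the transition term and in the last term. The constant that relates the divergence to the
    cloning loss is minus the mean entropy of the latent target policy, finite because [A] is. *)

Lemma esum_swap (T1 T2 : choiceType) (a : T1 -> T2 -> \bar R) :
  (forall i j, 0 <= a i j) ->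
  \esum_(i in [set: T1]) \esum_(j in [set: T2]) a i j =
  \esum_(j in [set: T2]) \esum_(i in [set: T1]) a i j.
Proof.
move=> a0; rewrite esum_esum// esum_esum//.
rewrite (reindex_esum ([set: T2] `*`` (fun=> [set: T1])) _ (fun x => (x.2, x.1)))//.
by split=> [[i j]//|[i1 i2] [j1 j2] _ _ [-> ->]//|[i j] _]; exists (j, i).
Qed.

Lemma esum_ge_term (T : choiceType) (f : T -> \bar R) x : (forall y, 0 <= f y) ->
  f x <= \esum_(y in [set: T]) f y.
Proof.
by move=> f0; rewrite (esumID [set x])// setTI esum_set1// leeDl// esum_ge0.
Qed.

Lemma esum_eq0 (T : choiceType) (f : T -> \bar R) : (forall y, 0 <= f y) ->
  \esum_(y in [set: T]) f y = 0 -> forall x, f x = 0.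
Proof.
by move=> f0 E x; apply/eqP; rewrite eq_le f0 andbT -E esum_ge_term.
Qed.

Lemma esum_pt (T : choiceType) (f : T -> \bar R) x : 0 <= f x ->
  (forall y, y != x -> f y = 0) -> \esum_(y in [set: T]) f y = f x.
Proof.
move=> fx0 f0; rewrite -(esum_set1 fx0) [RHS]esum_mkcond; apply: eq_esum => y _.
case: ifPn => //; rewrite notin_setE/= => /eqP yx; exact: f0.
Qed.

Lemma esum_finType (A : finType) (f : A -> \bar R) : (forall a, 0 <= f a) ->
  \esum_(a in [set: A]) f a = \sum_a f a.
Proof.
move=> f0; rewrite esum_fset//; last exact: finite_finset.
rewrite (fsbigTE [fset a | a in A]%fset) ?big_imfset//= => [|a]; last by rewrite !inE.
by rewrite big_enum.
Qed.

(** The one-sided bound [le], used for [r] and for [r^-1], gives equality for a finite positive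
    factor. For the factor [+oo], a single nonzero term already makes both sides infinite. *)
Lemma esumZ (T : choiceType) (c : \bar R) (f : T -> \bar R) : 0 <= c ->
  (forall x, 0 <= f x) ->
  \esum_(x in [set: T]) c * f x = c * \esum_(x in [set: T]) f x.
Proof.
move=> c0 f0.
have le (r : R) (g : T -> \bar R) : (0 <= r)%R -> (forall x, 0 <= g x) ->
    \esum_(x in [set: T]) r%:E * g x <= r%:E * \esum_(x in [set: T]) g x.
  move=> r0 g0; apply: ge_ereal_sup => _ [F [finF _] <-].
  rewrite fsbig_finite// -ge0_sume_distrr => [|x _]; last exact: g0.
  apply: lee_wpmul2l; rewrite ?lee_fin//; apply: esum_ge; exists F => //.
  by rewrite fsbig_finite.
have [c00|cpos] : c = 0 \/ 0 < c by move: c0; rewrite le_eqVlt => /orP[/eqP<-|]; [left|right].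
  by rewrite c00 mul0e esum1// => x _; rewrite mul0e.
case: c c0 cpos => [r| |]//; last first.
  move=> _ _; have [E|] := eqVneq (\esum_(x in [set: T]) f x) 0.
    by rewrite E mule0 esum1// => x _; rewrite (esum_eq0 f0 E) mule0.
  move=> E; have Ep : 0 < \esum_(x in [set: T]) f x by rewrite lt_neqAle eq_sym E esum_ge0.
  rewrite gt0_mulye//; apply/eqP; rewrite -leye_eq.
  have [x fx] : exists x, f x != 0.
    apply: contrapT => H; move: E; rewrite esum1 ?eqxx// => x _.
    by apply/eqP; apply: contrapT => /negP fx; apply: H; exists x.
  apply: le_trans (esum_ge_term x _); last by move=> y; rewrite mule_ge0// ?leey.
  by rewrite gt0_mulye// lt_neqAle eq_sym fx f0.
rewrite lee_fin lte_fin => r0 rpos; apply/eqP; rewrite eq_le le//=.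
have -> : \esum_(x in [set: T]) f x = \esum_(x in [set: T]) r^-1%:E * (r%:E * f x).
  by apply: eq_esum => x _; rewrite muleA -EFinM mulVf ?gt_eqF// mul1e.
apply: le_trans (_ : r%:E * (r^-1%:E * \esum_(x in [set: T]) (r%:E * f x)) <= _).
  apply: lee_wpmul2l => //; apply: le; first by rewrite invr_ge0.
  by move=> x; rewrite mule_ge0.
by rewrite muleA -EFinM divff ?gt_eqF// mul1e.
Qed.

(** Each [x] lies in exactly one fiber, so after exchanging the sums the inner one has at most one
    nonzero term. *)
Lemma esum_fiber (T U : choiceType) (phi : T -> U) (f : T -> \bar R) :
  (forall x, 0 <= f x) ->
  \esum_(x in [set: T]) f x =
  \esum_(z in [set: U]) \esum_(x in phi @^-1` [set z]) f x.
Proof.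
move=> f0; under [RHS]eq_esum do rewrite esum_mkcond.
rewrite esum_swap; last by move=> z x; case: ifP.
apply: eq_esum => x _; rewrite (@esum_pt _ _ (phi x)).
- by rewrite ifT// inE.
- by case: ifP.
- by move=> z zx; rewrite ifF//; apply/negbTE; rewrite notin_setE/= => /esym/eqP; exact/negP.
Qed.

Lemma usum_ge0 (T : choiceType) (f : T -> \bar R) : (forall x, 0 <= f x) ->
  usum f = \esum_(x in [set: T]) f x.
Proof.
move=> f0; rewrite /usum [X in _ - X]esum1; last first.
  by move=> x _; rewrite (ge0_funenegE (D := setT))// inE.
by rewrite sube0; apply: eq_esum => x _; rewrite (ge0_funeposE (D := setT))// inE.
Qed.

Lemma expect_ge0E (T : choiceType) (p : T -> R) (f : T -> \bar R) :
  (forall x, 0 <= p x)%R -> (forall x, 0 <= f x) ->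
  expect p f = \esum_(x in [set: T]) (p x)%:E * f x.
Proof. by move=> p0 f0; rewrite /expect usum_ge0// => x; rewrite mule_ge0// lee_fin. Qed.

End esum_extra.

Notation rsummable f := (summable [set: _] (EFin \o f)).

(** * Real-valued sums of signed summable families *)

Section rsum.
Context (R : realType).

Definition rsum (T : choiceType) (f : T -> R) : R := fine (usum (EFin \o f)).

Section one.
Context (T : choiceType).
Implicit Types f g : T -> R.

Lemma le_rsummable f g : (forall x, `|f x| <= g x) -> rsummable g -> rsummable f.
Proof.
move=> fg; apply: le_lt_trans; apply: le_esum => x _ /=.
by rewrite lee_fin (le_trans (fg x))// ler_norm.
Qed.

Lemma rsummable_ge0 f : (forall x, 0 <= f x) ->
  (\esum_(x in [set: T]) (f x)%:E < +oo)%E -> rsummable f.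
Proof.
move=> f0; rewrite /summable; under [X in _ -> (X < _)%E]eq_esum => x _.
  by rewrite /= ger0_norm//; over.
by [].
Qed.

Lemma rsumE f : (forall x, 0 <= f x) -> rsummable f ->
  (rsum f)%:E = (\esum_(x in [set: T]) (f x)%:E)%E.
Proof.
move=> f0 sf; rewrite /rsum usum_ge0//= fineK//.
move: sf; rewrite summableE; under eq_esum => x _ do rewrite /= ger0_norm//.
by [].
Qed.

Lemma rsummableD f g : rsummable f -> rsummable g -> rsummable (fun x => f x + g x).
Proof. exact: summableD. Qed.

Lemma rsummableB f g : rsummable f -> rsummable g -> rsummable (fun x => f x - g x).
Proof. exact: summableB. Qed.

Lemma rsummableZ c f : rsummable f -> rsummable (fun x => c * f x).
Proof.
move=> sf; rewrite /summable.
under eq_esum do rewrite /= normrM EFinM.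
by rewrite esumZ//; rewrite lte_mul_pinfty// lee_fin.
Qed.

Lemma rsummable_norm f : rsummable f -> rsummable (fun x => `|f x|).
Proof.
rewrite /summable; under [X in _ -> (X < _)%E]eq_esum do rewrite /= normr_id.
by [].
Qed.

(** Positive and negative parts as linear expressions in [|f|] and [f]: their summability is then a
    matter of linearity. *)
Let pos f x : R := 2^-1 * (`|f x| + f x).
Let neg f x : R := 2^-1 * (`|f x| - f x).

Let pos_ge0 f x : 0 <= pos f x.
Proof. by rewrite mulr_ge0// -lerBlDr sub0r -normrN ler_norm. Qed.

Let neg_ge0 f x : 0 <= neg f x.
Proof. by rewrite mulr_ge0// subr_ge0 ler_norm. Qed.

Let spos f : rsummable f -> rsummable (pos f).
Proof. by move=> sf; apply: rsummableZ; apply: rsummableD => //; exact: rsummable_norm. Qed.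

Let sneg f : rsummable f -> rsummable (neg f).
Proof. by move=> sf; apply: rsummableZ; apply: rsummableB => //; exact: rsummable_norm. Qed.

Let posneg f : f = (fun x => pos f x - neg f x).
Proof. by apply/funext => x; rewrite /pos /neg; field. Qed.

Let rsumB_ge0 f g : (forall x, 0 <= f x) -> (forall x, 0 <= g x) ->
  rsummable f -> rsummable g -> rsum (fun x => f x - g x) = rsum f - rsum g.
Proof.
move=> f0 g0 sf sg.
have f0' x : setT x -> (0 <= (EFin \o f) x)%E by rewrite /= lee_fin.
have g0' x : setT x -> (0 <= (EFin \o g) x)%E by rewrite /= lee_fin.
suff -> : rsum (fun x => f x - g x) = fine (rsum f - rsum g)%:E by [].
rewrite {1}/rsum /usum [X in fine X](esumB sf sg f0' g0') EFinB.
by rewrite (rsumE f0 sf) (rsumE g0 sg).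
Qed.

Let rsum_posneg f : rsummable f -> rsum f = rsum (pos f) - rsum (neg f).
Proof.
by move=> sf; rewrite {1}(posneg f) rsumB_ge0//; [exact: spos|exact: sneg].
Qed.

Let rsumD_ge0 f g : (forall x, 0 <= f x) -> (forall x, 0 <= g x) ->
  rsummable f -> rsummable g -> rsum (fun x => f x + g x) = rsum f + rsum g.
Proof.
move=> f0 g0 sf sg; apply: EFin_inj; rewrite EFinD !rsumE//.
- by rewrite -esumD// => x _; rewrite lee_fin.
- by move=> x; rewrite addr_ge0.
- exact: rsummableD.
Qed.

Lemma rsumD f g : rsummable f -> rsummable g ->
  rsum (fun x => f x + g x) = rsum f + rsum g.
Proof.
move=> sf sg.
have -> : (fun x => f x + g x) =
    (fun x => (pos f x + pos g x) - (neg f x + neg g x)).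
  by apply/funext => x; rewrite /pos /neg; field.
rewrite rsumB_ge0//; do ?by move=> x; rewrite addr_ge0.
- rewrite (@rsumD_ge0 (pos f) (pos g))//; [|exact: spos|exact: spos].
  rewrite (@rsumD_ge0 (neg f) (neg g))//; [|exact: sneg|exact: sneg].
  by rewrite (rsum_posneg sf) (rsum_posneg sg); ring.
- by apply: rsummableD; exact: spos.
- by apply: rsummableD; exact: sneg.
Qed.

Lemma rsum0 : rsum (fun _ : T => 0) = 0.
Proof. by rewrite /rsum usum_ge0//= esum1. Qed.

Lemma rsumN f : rsummable f -> rsum (fun x => - f x) = - rsum f.
Proof.
move=> sf; have sNf : rsummable (fun x => - f x).
  by apply: le_rsummable (rsummable_norm sf) => x; rewrite normrN.
apply/eqP; rewrite -addr_eq0 -rsumD//.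
by under eq_fun do rewrite addNr; rewrite rsum0.
Qed.

Lemma rsumB f g : rsummable f -> rsummable g ->
  rsum (fun x => f x - g x) = rsum f - rsum g.
Proof.
move=> sf sg; rewrite rsumD ?rsumN//.
by apply: le_rsummable (rsummable_norm sg) => x; rewrite normrN.
Qed.

Lemma rsumZ c f : rsummable f -> rsum (fun x => c * f x) = c * rsum f.
Proof.
have ge0 (k : R) g : 0 <= k -> (forall x, 0 <= g x) -> rsummable g ->
    rsum (fun x => k * g x) = k * rsum g.
  move=> k0 g0 sg; apply: EFin_inj; rewrite EFinM !rsumE//.
  - under eq_esum do rewrite EFinM.
    by rewrite esumZ// ?lee_fin// => x; rewrite lee_fin.
  - by move=> x; rewrite mulr_ge0.
  - exact: rsummableZ.
have pos_case (k : R) : 0 <= k -> rsummable f -> rsum (fun x => k * f x) = k * rsum f.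
  move=> k0 sf.
  have -> : (fun x => k * f x) = (fun x => k * pos f x - k * neg f x).
    by apply/funext => x; rewrite -mulrBr {1}(posneg f).
  rewrite rsumB; [|exact/rsummableZ/spos|exact/rsummableZ/sneg].
  by rewrite (ge0 _ (pos f))// ?(ge0 _ (neg f))// -?mulrBr -?rsum_posneg//; [exact: sneg|exact: spos].
move=> sf; have [c0|c0] := leP 0 c; first exact: pos_case.
have -> : (fun x => c * f x) = (fun x => - ((- c) * f x)).
  by apply/funext => x; rewrite mulNr opprK.
by rewrite rsumN; [rewrite pos_case ?oppr_ge0 1?ltW// mulNr opprK|exact: rsummableZ].
Qed.

Lemma rsum_ge0 f : (forall x, 0 <= f x) -> 0 <= rsum f.
Proof. by move=> f0; rewrite fine_ge0// usum_ge0// esum_ge0// => x _; rewrite lee_fin. Qed.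

Lemma ler_rsum f g : rsummable f -> rsummable g -> (forall x, f x <= g x) ->
  rsum f <= rsum g.
Proof.
move=> sf sg fg; rewrite -subr_ge0 -rsumB//.
by apply: rsum_ge0 => x; rewrite subr_ge0.
Qed.

Lemma ler_norm_rsum f g : rsummable g -> (forall x, `|f x| <= g x) ->
  `|rsum f| <= rsum g.
Proof.
move=> sg fg; have sf := le_rsummable fg sg.
rewrite ler_norml -rsumN//; apply/andP; split; apply: ler_rsum => //.
- by apply: le_rsummable (rsummable_norm sg) => x; rewrite normrN.
- by move=> x; have := fg x; rewrite ler_norml => /andP[].
- by move=> x; have := fg x; rewrite ler_norml => /andP[].
Qed.

Lemma rsum_pt f x : (forall y, y != x -> f y = 0) -> rsum f = f x.
Proof.
move=> f0; pose u y : R := (y == x)%:R.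
have E : (\esum_(y in [set: T]) (u y)%:E = 1)%E.
  rewrite (esum_pt (x := x)) /u ?eqxx//.
  by move=> y /negbTE ->.
have u0 y : 0 <= u y by [].
have su : rsummable u by apply: rsummable_ge0; rewrite ?E ?ltry.
have -> : f = (fun y => f x * u y).
  apply/funext => y; rewrite /u; have [->|/f0->] := eqVneq y x; rewrite ?mulr1 ?mulr0//.
by rewrite rsumZ// -(mulr1 (f x)) /u eqxx mulr1; congr (_ * _); apply: EFin_inj; rewrite rsumE.
Qed.

Lemma rsummable_sum (I : Type) (r : seq I) (F : I -> T -> R) :
  (forall i, rsummable (F i)) -> rsummable (fun x => \sum_(i <- r) F i x).
Proof.
move=> sF; elim: r => [|i r ih].
  by rewrite /summable esum1 ?ltry// => x _ /=; rewrite big_nil normr0.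
have -> : (fun x => \sum_(j <- i :: r) F j x) = (fun x => F i x + \sum_(j <- r) F j x).
  by apply/funext => x; rewrite big_cons.
exact: rsummableD.
Qed.

Lemma rsum_sum (I : Type) (r : seq I) (F : I -> T -> R) :
  (forall i, rsummable (F i)) ->
  rsum (fun x => \sum_(i <- r) F i x) = \sum_(i <- r) rsum (F i).
Proof.
move=> sF; elim: r => [|i r ih].
  by rewrite big_nil -[RHS]rsum0; congr rsum; apply/funext => x; rewrite big_nil.
have -> : (fun x => \sum_(j <- i :: r) F j x) = (fun x => F i x + \sum_(j <- r) F j x).
  by apply/funext => x; rewrite big_cons.
by rewrite rsumD ?ih ?big_cons//; exact: rsummable_sum.
Qed.

End one.

(** Fubini from Tonelli: the positive and negative parts of [f] are dominated by [|f|], and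
    [esum_swap] applies to each. *)
Lemma rsum_swap (T U : choiceType) (f : T -> U -> R) :
  (\esum_(x in [set: T]) \esum_(y in [set: U]) `|f x y|%:E < +oo)%E ->
  rsum (fun x => rsum (f x)) = rsum (fun y => rsum (f ^~ y)).
Proof.
move=> sf.
have sf' : (\esum_(y in [set: U]) \esum_(x in [set: T]) `|f x y|%:E < +oo)%E.
  by rewrite esum_swap// => y x; rewrite lee_fin.
have in1 x : rsummable (f x).
  apply: le_lt_trans sf; apply: (@esum_ge_term _ _ (fun x => \esum_(y in [set: U]) `|f x y|%:E)%E) => y.
  by apply: esum_ge0 => z _; rewrite lee_fin.
have in2 y : rsummable (f ^~ y).
  apply: le_lt_trans sf'; apply: (@esum_ge_term _ _ (fun y => \esum_(x in [set: T]) `|f x y|%:E)%E) => x.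
  by apply: esum_ge0 => z _; rewrite lee_fin.
(* Inner sums of a dominated family are summable; the index types are generic because both orders of
   summation need it. *)
have out (V W : choiceType) (g h : V -> W -> R) : (forall x y, `|h x y| <= `|g x y|) ->
    (\esum_(x in [set: V]) \esum_(y in [set: W]) `|g x y|%:E < +oo)%E ->
    (forall x, rsummable (g x)) ->
    rsummable (fun x => rsum (h x)).
  move=> hg s1 s2; apply: le_lt_trans s1; apply: le_esum => x _ /=.
  rewrite -(@rsumE _ (fun y => `|g x y|)) ?lee_fin//; last exact: rsummable_norm.
  by apply: ler_norm_rsum => //; exact: rsummable_norm.
have ge0 (g : T -> U -> R) : (forall x y, `|g x y| <= `|f x y|) -> (forall x y, 0 <= g x y) ->
    rsum (fun x => rsum (g x)) = rsum (fun y => rsum (g ^~ y)).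
  move=> gf g0; apply: EFin_inj; rewrite !rsumE; do ?by move=> x; exact: rsum_ge0.
  - transitivity (\esum_(x in [set: T]) \esum_(y in [set: U]) (g x y)%:E)%E.
      apply: eq_esum => x _; rewrite rsumE//.
      by apply: le_rsummable (rsummable_norm (in1 x)).
    rewrite esum_swap//; apply: eq_esum => y _; rewrite rsumE//.
    exact: le_rsummable (rsummable_norm (in2 y)).
  - exact: (out _ _ (fun y x => f x y)).
  - exact: (out _ _ f).
pose p x y : R := 2^-1 * (`|f x y| + f x y).
pose n x y : R := 2^-1 * (`|f x y| - f x y).
have lp x y : `|p x y| <= `|f x y|.
  rewrite /p; have [f0|f0] := ger0P (f x y).
    by rewrite ger0_norm; lra.
  by rewrite addNr mulr0 normr0; lra.
have ln x y : `|n x y| <= `|f x y|.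
  rewrite /n; have [f0|f0] := ger0P (f x y).
    by rewrite subrr mulr0 normr0; lra.
  by rewrite ger0_norm; lra.
have p0 x y : 0 <= p x y.
  by rewrite /p; have [f0|f0] := ger0P (f x y); lra.
have n0 x y : 0 <= n x y.
  by rewrite /n; have [f0|f0] := ger0P (f x y); lra.
have fE : f = (fun x y => p x y - n x y).
  by apply/funext => x; apply/funext => y; rewrite /p /n; field.
have sp1 x : rsummable (p x) by apply: le_rsummable (rsummable_norm (in1 x)).
have sn1 x : rsummable (n x) by apply: le_rsummable (rsummable_norm (in1 x)).
have sp2 y : rsummable (p ^~ y) by apply: le_rsummable (rsummable_norm (in2 y)).
have sn2 y : rsummable (n ^~ y) by apply: le_rsummable (rsummable_norm (in2 y)).
rewrite fE; transitivity (rsum (fun x => rsum (p x) - rsum (n x))).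
  by congr rsum; apply/funext => x; rewrite rsumB.
transitivity (rsum (fun y => rsum (p ^~ y) - rsum (n ^~ y))); last first.
  by congr rsum; apply/funext => y; rewrite rsumB.
rewrite !rsumB ?ge0//.
- exact: (out _ _ (fun y x => f x y) (fun y x => p x y)).
- exact: (out _ _ (fun y x => f x y) (fun y x => n x y)).
- exact: (out _ _ f).
- exact: (out _ _ f).
Qed.

(** Link with the limits of partial sums by which returns and visitation are defined. *)
Lemma rsum_nat (u : nat -> R) : rsummable u ->
  series u @ \oo --> rsum u.
Proof.
have ge0 (v : nat -> R) : (forall n, 0 <= v n) -> rsummable v -> series v @ \oo --> rsum v.
  move=> v0 sv; have sv' : summable (xpredT : pred nat) (EFin \o v).
    rewrite /summable (_ : (fun=> is_true true) = [set: nat])//.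
    by apply/seteqP; split.
  have v0' i : xpredT i -> (0 <= (EFin \o v) i)%E by rewrite /= lee_fin.
  have cv := summable_cvg v0' sv'.
  suff -> : rsum v = limn (series v) by [].
  apply: EFin_inj; rewrite rsumE// -nneseries_esumT//.
  by rewrite summable_nneseries_lim// => i _; rewrite lee_fin.
move=> su.
pose p n : R := 2^-1 * (`|u n| + u n); pose m n : R := 2^-1 * (`|u n| - u n).
have uE : u = (fun n => p n - m n) by apply/funext => n; rewrite /p /m; field.
have p0 n : 0 <= p n by rewrite /p; case: (ger0P (u n)) => ?; lra.
have m0 n : 0 <= m n by rewrite /m; case: (ger0P (u n)) => ?; lra.
have sp : rsummable p by apply: rsummableZ; apply: rsummableD => //; exact: rsummable_norm.
have sm : rsummable m by apply: rsummableZ; apply: rsummableB => //; exact: rsummable_norm.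
rewrite [in rsum _]uE rsumB//.
have -> : series u = series p \- series m.
  by apply/funext => n; rewrite /series/= -sumrB; apply: eq_bigr => i _; rewrite [in LHS]uE.
by apply: cvgB; exact: ge0.
Qed.

Lemma rsum_natS (u : nat -> R) : rsummable u -> rsummable (fun n => u n.+1) ->
  rsum u = u 0%N + rsum (fun n => u n.+1).
Proof.
move=> su suS; apply: (cvg_unique _ (rsum_nat su)) => //=.
rewrite -(cvg_shiftS (series u)).
have -> : [sequence series u n.+1]_n = (fun n => u 0%N + series (fun n => u n.+1) n).
  by apply/funext => n /=; rewrite /series/= big_nat_recl.
by apply: cvgD; [exact: cvg_cst|exact: rsum_nat].
Qed.

End rsum.

(** * Cauchy-Schwarz and Pinsker inequalities *)

Section cauchy_schwarz.
Context (R : realType).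
Local Open Scope ereal_scope.

(** Requiring [h] only to be dominated by the product of roots fits pointwise inequalities.
    Degenerate sums are removed before the main estimate: a zero sum forces [h] to vanish, and an
    infinite one makes the right-hand side [+oo] because the other is positive. *)
Lemma esum_cauchy_schwarz (T : choiceType) (f g h : T -> \bar R) :
  (forall x, 0 <= f x) -> (forall x, 0 <= g x) -> (forall x, 0 <= h x) ->
  (forall x, h x <= sqrte (f x) * sqrte (g x)) ->
  \esum_(x in [set: T]) h x <=
  sqrte (\esum_(x in [set: T]) f x) * sqrte (\esum_(x in [set: T]) g x).
Proof.
move=> f0 g0 h0 hfg.
set F := \esum_(x in _) f x; set G := \esum_(x in _) g x.
have F0 : 0 <= F by apply: esum_ge0.
have G0 : 0 <= G by apply: esum_ge0.
have [FE|Fn] := eqVneq F 0.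
  rewrite esum1 ?mule_ge0 ?sqrte_ge0// => x _; apply/eqP; rewrite eq_le h0 andbT.
  by rewrite (le_trans (hfg x))// (esum_eq0 f0 FE) sqrte0 mul0e.
have [GE|Gn] := eqVneq G 0.
  rewrite esum1 ?mule_ge0 ?sqrte_ge0// => x _; apply/eqP; rewrite eq_le h0 andbT.
  by rewrite (le_trans (hfg x))// (esum_eq0 g0 GE) sqrte0 mule0.
have Fp : 0 < F by rewrite lt_neqAle eq_sym Fn.
have Gp : 0 < G by rewrite lt_neqAle eq_sym Gn.
have sp (x : \bar R) : 0 < x -> 0 < sqrte x.
  by case: x => [r| |]//; rewrite !lte_fin sqrtr_gt0.
have [FE|Foo] := eqVneq F +oo; first by rewrite FE/= gt0_mulye ?leey// sp.
have [GE|Goo] := eqVneq G +oo; first by rewrite GE/= gt0_muley ?leey// sp.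
have Ff : F \is a fin_num by rewrite ge0_fin_numE// lt_neqAle Foo leey.
have Gf : G \is a fin_num by rewrite ge0_fin_numE// lt_neqAle Goo leey.
have FE : F = (fine F)%:E by rewrite fineK.
have GE : G = (fine G)%:E by rewrite fineK.
move: Fp Gp; rewrite FE GE !lte_fin; set a := Num.sqrt (fine F); set b := Num.sqrt (fine G) => Fp Gp.
have ap : (0 < a)%R by rewrite sqrtr_gt0.
have bp : (0 < b)%R by rewrite sqrtr_gt0.
rewrite /= -/a -/b -EFinM.
pose l : R := (b / a)%R; have lp : (0 < l)%R by rewrite divr_gt0.
(* AM-GM with the weight [b / a] that turns the two sums into [a b]. *)
have bound x : h x <= (l / 2)%:E * f x + (l^-1 / 2)%:E * g x.
  have fx : f x \is a fin_num.
    by rewrite ge0_fin_numE//; apply: le_lt_trans (esum_ge_term x f0) _; rewrite -/F FE ltry.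
  have gx : g x \is a fin_num.
    by rewrite ge0_fin_numE//; apply: le_lt_trans (esum_ge_term x g0) _; rewrite -/G GE ltry.
  apply: le_trans (hfg x) _; have := f0 x; have := g0 x.
  rewrite -(fineK fx) -(fineK gx) !lee_fin/= => gx0 fx0.
  rewrite -[X in (_ <= _ / 2 * X + _)%R]sqr_sqrtr// -[X in (_ <= _ + _ / 2 * X)%R]sqr_sqrtr//.
  set u := Num.sqrt (fine (f x)); set v := Num.sqrt (fine (g x)).
  rewrite -subr_ge0.
  have -> : (l / 2 * u ^+ 2 + l^-1 / 2 * v ^+ 2 - u * v = (l * u - v) ^+ 2 / (2 * l))%R.
    by field; rewrite gt_eqF.
  by rewrite divr_ge0 ?sqr_ge0// mulr_ge0// ltW.
have l2 : (0 <= l / 2)%R by rewrite divr_ge0// ltW.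
have l2' : (0 <= l^-1 / 2)%R by rewrite divr_ge0// invr_ge0 ltW.
apply: le_trans (le_esum (fun x _ => bound x)) _.
rewrite esumD; [|by move=> x _; rewrite mule_ge0// lee_fin..].
rewrite !esumZ ?lee_fin// -/F -/G FE GE lee_fin -[fine F](sqr_sqrtr (ltW Fp)) -[fine G](sqr_sqrtr (ltW Gp)) -/a -/b.
rewrite le_eqVlt; apply/orP; left; apply/eqP; rewrite /l; field.
by rewrite !gt_eqF.
Qed.

(** Jensen's inequality for the square root, from Cauchy-Schwarz and
    [d sqrt g = sqrt d * sqrt (d g)]. *)
Lemma esum_sqrt_le (T : choiceType) (d : T -> R) (g : T -> \bar R) :
  (forall x, 0 <= d x)%R -> (\esum_(x in [set: T]) (d x)%:E <= 1) ->
  (forall x, 0 <= g x) ->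
  \esum_(x in [set: T]) (d x)%:E * sqrte (g x) <=
  sqrte (\esum_(x in [set: T]) (d x)%:E * g x).
Proof.
move=> d0 d1 g0.
have d0e x : 0 <= (d x)%:E by rewrite lee_fin.
apply: le_trans (@esum_cauchy_schwarz _ (fun x => (d x)%:E) (fun x => (d x)%:E * g x) _ _ _ _ _) _ => //.
- by move=> x; rewrite mule_ge0.
- by move=> x; rewrite mule_ge0 ?sqrte_ge0.
- by move=> x; rewrite sqrteM// muleA -expe2 sqr_sqrte.
- rewrite -[leRHS]mul1e; apply: lee_wpmul2r; first exact: sqrte_ge0.
  by rewrite (_ : 1 = sqrte 1) ?lee_sqrt//= sqrtr1.
Qed.

End cauchy_schwarz.

(** * Pinsker's inequality from a scalar logarithmic inequality *)

Section pinsker.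
Context (R : realType).

(** The sign condition says that [c] lies on the same side of 1 as [t], so that one sign argument
    serves both sides. *)
Lemma MVT_from1 (f df : R -> R) (t : R) : 0 < t ->
  (forall x : R, 0 < x -> is_derive x (1 : R) f (df x)) ->
  exists2 c : R, 0 < c /\ (c - 1) * (t - 1) >= 0 & f t - f 1 = df c * (t - 1).
Proof.
move=> t0 dF.
have cf (a b : R) : 0 < a -> {within `[a, b], continuous f}.
  move=> a0; apply: derivable_within_continuous => x; rewrite in_itv/= => /andP[ax _].
  by have [] := dF x (lt_le_trans a0 ax).
have [t1|t1] := leP t 1.
  have dt x : x \in `]t, 1[%R -> is_derive x (1 : R) f (df x).
    by rewrite in_itv/= => /andP[tx _]; apply: dF; exact: lt_trans tx.
  have [c] := MVT_segment t1 dt (cf _ _ t0).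
  rewrite in_itv/= => /andP[tc c1] E; exists c.
    split; first lra.
    by nra.
  by rewrite -opprB E; ring.
have dt x : x \in `]1, t[%R -> is_derive x (1 : R) f (df x).
  by rewrite in_itv/= => /andP[tx _]; apply: dF; exact: lt_trans tx.
have [c] := MVT_segment (ltW t1) dt (cf _ _ ltr01).
rewrite in_itv/= => /andP[tc c1] E; exists c => //.
split; first lra.
by nra.
Qed.

(* The difference [F] of the two sides satisfies [F 1 = 0] and [F' = 4 H], where
   [H 1 = 0] and [H' u = ln u + u^-1 - 1 >= 0]. *)
Lemma ln_pinsker (t : R) : 0 < t ->
  3 * (t - 1) ^+ 2 <= (4 + 2 * t) * (t * ln t - t + 1).
Proof.
pose H (u : R) := (u + 1) * ln u - 2 * (u - 1).
pose F (u : R) := (4 + 2 * u) * (u * ln u - u + 1) - 3 * (u - 1) ^+ 2.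
have dH (u : R) : 0 < u -> is_derive u (1 : R) H (ln u + u^-1 - 1).
  move=> u0; have dl := is_derive1_ln u0.
  have -> : H = ((id + cst 1) * @ln R - (cst 2 * (id - cst 1)))%R by apply/funext => x.
  apply: is_derive_eq; rewrite /= !fctE /GRing.scale/=.
  by field; rewrite gt_eqF.
have dF (u : R) : 0 < u -> is_derive u (1 : R) F (4 * H u).
  move=> u0; have dl := is_derive1_ln u0.
  (* Collected polynomial part: [(4 + 2u)(1 - u) - 3(u - 1)^2 = -(5u^2 - 4u - 1)]. *)
  have -> : F = ((cst 4 + cst 2 * id) * id * @ln R - ((cst 5 * id - cst 4) * id - cst 1))%R.
    by apply/funext => x; rewrite /F !fctE; ring.
  apply: is_derive_eq; rewrite /GRing.scale/= !fctE /H.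
  by field; rewrite gt_eqF.
have lnV (u : R) : 0 < u -> 0 <= ln u + u^-1 - 1.
  move=> u0; have u1 : -1 < u^-1 - 1 by rewrite ltrBrDr addNr invr_gt0.
  have := le_ln1Dx u1; rewrite addrC subrK lnV ?posrE//; lra.
move=> t0.
have H_sign (u : R) : 0 < u -> 0 <= H u * (u - 1).
  move=> u0; have [c [c0 _] E] := MVT_from1 u0 dH.
  have H1 : H 1 = 0 by rewrite /H ln1; ring.
  move: E; rewrite H1 subr0 => ->; rewrite -mulrA mulr_ge0 ?lnV// -expr2 sqr_ge0//.
have [c [c0 ct] E] := MVT_from1 t0 dF.
have F1 : F 1 = 0 by rewrite /F ln1; ring.
rewrite -subr_ge0 -/(F t); move: E; rewrite F1 subr0 => ->.
(* [H c] has the sign of [c - 1], which agrees with that of [t - 1]. *)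
have := H_sign _ c0.
have [->|c1] := eqVneq c 1; first by rewrite /H ln1 !(subrr, mulr0, subr0, mul0r).
have [c1'|c1'] := leP c 1.
  have c1n : c - 1 < 0 by rewrite subr_lt0 lt_neqAle c1.
  rewrite nmulr_lge0// => Hc; move: ct; rewrite nmulr_rge0// => tn.
  by rewrite mulr_le0// mulr_ge0_le0.
have c1p : 0 < c - 1 by rewrite subr_gt0.
rewrite pmulr_lge0// => Hc; move: ct; rewrite pmulr_rge0// => tn.
by rewrite mulr_ge0// mulr_ge0.
Qed.

Local Open Scope ereal_scope.

(* The Kullback-Leibler integrand shifted by [q - p]: the shift sums to zero, and
   the shifted terms are nonnegative. *)
Definition kl_term (p q : R) : \bar R :=
  if p == 0%R then q%:E else
  if q == 0%R then +oo else (p * (ln p - ln q) - p + q)%:E.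

(** The scalar inequality at [t = p / q], made homogeneous by the factor [q ^+ 2]. *)
Let kl_fin (p q : R) : (0 < p)%R -> (0 < q)%R ->
  (3 * (p - q) ^+ 2 <= (4 * q + 2 * p) * (p * (ln p - ln q) - p + q))%R.
Proof.
move=> p0 q0; have := ln_pinsker (divr_gt0 p0 q0); rewrite ln_div ?posrE//.
have q2 : (0 <= q ^+ 2)%R by exact: sqr_ge0.
move=> /(ler_wpM2l q2); apply: etrans; congr (_ <= _)%R; field; by rewrite gt_eqF.
Qed.

Lemma kl_term_ge0 (p q : R) : (0 <= p)%R -> (0 <= q)%R -> 0 <= kl_term p q.
Proof.
rewrite /kl_term => p0 q0; case: eqVneq => [_|pn]; first by rewrite lee_fin.
case: eqVneq => // qn; rewrite lee_fin.
have pp : (0 < p)%R by rewrite lt_neqAle eq_sym pn.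
have qp : (0 < q)%R by rewrite lt_neqAle eq_sym qn.
have pq : (0 < 4 * q + 2 * p)%R by lra.
rewrite -(pmulr_rge0 _ pq); apply: le_trans (kl_fin pp qp).
by rewrite mulr_ge0// sqr_ge0.
Qed.

(** Factored for Cauchy-Schwarz: over two distributions the weights [(4 q + 2 p) / 3] sum to 2, and
    the other factors sum to the divergence. *)
Lemma le_sqrt_kl_term (p q : R) : (0 <= p)%R -> (0 <= q)%R ->
  `|p - q|%:E <= sqrte ((4 * q + 2 * p) / 3)%:E * sqrte (kl_term p q).
Proof.
move=> p0 q0.
have h0 : (0 <= (4 * q + 2 * p) / 3)%R by rewrite divr_ge0//; lra.
rewrite -sqrteM ?lee_fin// (_ : `|p - q|%:E = `|(p - q)%:E|)// -sqrte_sqr lee_sqrt; last first.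
  by rewrite mule_ge0 ?lee_fin// kl_term_ge0.
rewrite /kl_term; case: eqVneq => [->|pn].
  by rewrite -EFin_expe -EFinM lee_fin; nra.
have pp : (0 < p)%R by rewrite lt_neqAle eq_sym pn.
case: eqVneq => [qe|qn].
  by rewrite qe mulr0 add0r gt0_muley ?leey// lte_fin; lra.
have qp : (0 < q)%R by rewrite lt_neqAle eq_sym qn.
rewrite -EFin_expe -EFinM lee_fin.
by have := kl_fin pp qp; lra.
Qed.

Let f (p q : R) : \bar R := p%:E * (lne p%:E - lne q%:E).

Let f_fin (p q : R) : (0 < p)%R -> (0 < q)%R -> f p q = (p * (ln p - ln q))%:E.
Proof. by move=> p0 q0; rewrite /f !lne_EFin. Qed.

Let f_0 (q : R) : f 0%R q = 0. Proof. by rewrite /f mul0e. Qed.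

Let f_y (p : R) : (0 < p)%R -> f p 0%R = +oo.
Proof.
move=> p0; rewrite /f lne_EFin// (le0_lneNy (x := 0%:E))//= addey//.
by rewrite gt0_muley ?lte_fin.
Qed.

(** Negative parts are dominated by [q], hence summable: the divergence is never [+oo - +oo]. *)
Let f_neg (p q : R) : (0 <= p)%R -> (0 <= q)%R -> maxe (- f p q) 0 <= q%:E.
Proof.
move=> p0 q0; rewrite ge_max lee_fin q0 andbT.
have [->|pn] := eqVneq p 0%R; first by rewrite f_0 oppe0 lee_fin.
have pp : (0 < p)%R by rewrite lt_neqAle eq_sym pn.
have [->|qn] := eqVneq q 0%R; first by rewrite f_y// leNye.
have qp : (0 < q)%R by rewrite lt_neqAle eq_sym qn.
have := kl_term_ge0 p0 q0; rewrite /kl_term (negbTE pn) (negbTE qn) f_fin//.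
by rewrite !lee_fin; lra.
Qed.

(** This is [kl_term = f - p + q] with every subtraction moved across, so that it also holds when
    [f] is [+oo] and can be summed over nonnegative families. *)
Let f_posneg (p q : R) : (0 <= p)%R -> (0 <= q)%R ->
  maxe (f p q) 0 + q%:E = kl_term p q + (p%:E + maxe (- f p q) 0).
Proof.
move=> p0 q0; rewrite /kl_term.
have [->|pn] := eqVneq p 0%R.
  by rewrite f_0 oppe0 maxxx !(add0e, adde0).
have pp : (0 < p)%R by rewrite lt_neqAle eq_sym pn.
have [->|qn] := eqVneq q 0%R.
  by rewrite f_y// maxye adde0 addye//= maxNye adde0.
have qp : (0 < q)%R by rewrite lt_neqAle eq_sym qn.
rewrite f_fin// -EFinN -!EFin_max -!EFinD; congr EFin.
set u := (p * _)%R; case: (leP u 0%R) => u0.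
  by rewrite (max_idPl _) ?oppr_ge0//; lra.
by rewrite (max_idPr _) ?oppr_le0 ?ltW//; lra.
Qed.

Section sums.
Context (T : choiceType) (p q : T -> R).
Hypotheses (p0 : forall x, (0 <= p x)%R) (q0 : forall x, (0 <= q x)%R).
Hypothesis (p1 : \esum_(x in [set: T]) (p x)%:E = 1).
Hypothesis (q1 : \esum_(x in [set: T]) (q x)%:E = 1).

(** Since [p] and [q] both have mass 1, the shift cancels after summation; only the mass 1 and the
    finite sum of negative parts are ever subtracted. *)
Lemma D_KL_esum : D_KL p q = \esum_(x in [set: T]) kl_term (p x) (q x).
Proof.
rewrite /D_KL /expect /usum; pose g x := f (p x) (q x); rewrite -/g.
have sn : \esum_(x in [set: T]) g^\- x \is a fin_num.
  rewrite ge0_fin_numE ?esum_ge0//; apply: (@le_lt_trans _ _ 1); last exact: ltry.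
  by rewrite -q1; apply: le_esum => x _; rewrite funenegE; exact: f_neg.
have E : \esum_(x in [set: T]) g^\+ x + 1 =
    \esum_(x in [set: T]) kl_term (p x) (q x) + (1 + \esum_(x in [set: T]) g^\- x).
  rewrite -{1}q1 -p1 -!esumD//; do ?by move=> x _; rewrite ?lee_fin ?kl_term_ge0 ?adde_ge0 ?lee_fin.
  by apply: eq_esum => x _; rewrite funeposE funenegE; exact: f_posneg.
move: E; rewrite addeA addeAC => /(congr1 (fun x => x - 1)).
by rewrite !addeK// => ->; rewrite addeK.
Qed.

Lemma D_KL_ge0 : 0 <= D_KL p q.
Proof. by rewrite D_KL_esum esum_ge0// => x _; exact: kl_term_ge0. Qed.

Lemma pinsker :
  \esum_(x in [set: T]) `|p x - q x|%:E <= 2%:E * sqrte (2^-1%:E * D_KL p q).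
Proof.
apply: le_trans (esum_cauchy_schwarz _ _ _ (fun x => le_sqrt_kl_term (p0 x) (q0 x))) _.
- by move=> x; rewrite lee_fin divr_ge0//; have := p0 x; have := q0 x; lra.
- by move=> x; exact: kl_term_ge0.
- by move=> x; rewrite lee_fin.
rewrite -D_KL_esum.
have -> : \esum_(x in [set: T]) ((4 * q x + 2 * p x) / 3)%:E = 2%:E.
  transitivity (\esum_(x in [set: T]) ((4 / 3)%:E * (q x)%:E + (2 / 3)%:E * (p x)%:E)).
    by apply: eq_esum => x _; rewrite -!EFinM -EFinD; congr EFin; field.
  rewrite esumD; do ?by move=> x _; rewrite mule_ge0// lee_fin ?divr_ge0.
  rewrite !esumZ ?lee_fin ?divr_ge0//; do ?by move=> x; rewrite lee_fin.
  by rewrite p1 q1 !mule1 -EFinD; congr EFin; field.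
rewrite sqrteM ?lee_fin// muleA /= -EFinM.
(* Cauchy-Schwarz yields [sqrt 2 * sqrt D_KL]; the form [2 * sqrt (2^-1 * D_KL)] matches the factor
   under the root in the transition loss. *)
suff -> : (2 * Num.sqrt 2^-1 = Num.sqrt 2 :> R)%R by [].
apply/eqP; rewrite -(eqrXn2 (n := 2))// ?mulr_ge0 ?sqrtr_ge0// exprMn !sqr_sqrtr//.
by apply/eqP; field.
Qed.

End sums.
End pinsker.

(** * Returns and visitation of a policy *)

Section expectation.
Context (R : realType).

Definition mean (T : choiceType) (p f : T -> R) : R := rsum (fun x => p x * f x).

Definition fbounded (T : Type) (f : T -> R) := exists B, forall x, `|f x| <= B.

Lemma fboundedD (T : Type) (f g : T -> R) :
  fbounded f -> fbounded g -> fbounded (fun x => f x + g x).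
Proof.
move=> [B fB] [C gC]; exists (B + C) => x.
by rewrite (le_trans (ler_normD _ _))// lerD.
Qed.

Lemma fboundedZ (T : Type) c (f : T -> R) : fbounded f -> fbounded (fun x => c * f x).
Proof. by move=> [B fB]; exists (`|c| * B) => x; rewrite normrM ler_wpM2l. Qed.

Lemma fboundedB (T : Type) (f g : T -> R) :
  fbounded f -> fbounded g -> fbounded (fun x => f x - g x).
Proof.
move=> [B fB] [C gC]; exists (B + C) => x.
by rewrite (le_trans (ler_normB _ _))// lerD.
Qed.

Context (T : choiceType) (p : distr R T).
Implicit Types f g : T -> R.

Lemma rsummable_distr : rsummable p.
Proof. by apply: rsummable_ge0; [exact: distr_ge0|rewrite distr_sum1 ltry]. Qed.

Lemma rsum_distr : rsum p = 1.
Proof.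
by apply: EFin_inj; rewrite rsumE ?distr_sum1//; [exact: distr_ge0|exact: rsummable_distr].
Qed.

Lemma rsummable_mean f : fbounded f -> rsummable (fun x => p x * f x).
Proof.
move=> [B fB]; apply: (@le_rsummable _ _ _ (fun x => B * p x)).
  by move=> x; rewrite normrM mulrC (ger0_norm (distr_ge0 p x)) ler_wpM2r ?distr_ge0.
exact/rsummableZ/rsummable_distr.
Qed.

Lemma meanD f g : fbounded f -> fbounded g ->
  mean p (fun x => f x + g x) = mean p f + mean p g.
Proof.
move=> bf bg; rewrite /mean -rsumD; do ?exact: rsummable_mean.
by congr rsum; apply/funext => x; rewrite mulrDr.
Qed.

Lemma meanB f g : fbounded f -> fbounded g ->
  mean p (fun x => f x - g x) = mean p f - mean p g.
Proof.
move=> bf bg; rewrite /mean -rsumB; do ?exact: rsummable_mean.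
by congr rsum; apply/funext => x; rewrite mulrBr.
Qed.

Lemma meanZ c f : fbounded f -> mean p (fun x => c * f x) = c * mean p f.
Proof.
move=> bf; rewrite /mean -rsumZ; last exact: rsummable_mean.
by congr rsum; apply/funext => x; rewrite mulrCA.
Qed.

Lemma mean_cst c : mean p (fun=> c) = c.
Proof.
rewrite /mean -[RHS]mulr1 -rsum_distr -rsumZ; last exact: rsummable_distr.
by congr rsum; apply/funext => x; rewrite mulrC.
Qed.

Lemma ler_norm_mean f B : (forall x, `|f x| <= B) -> `|mean p f| <= B.
Proof.
move=> fB; rewrite -[B]mulr1 -rsum_distr -rsumZ; last exact: rsummable_distr.
apply: ler_norm_rsum; first exact/rsummableZ/rsummable_distr.
by move=> x; rewrite normrM mulrC (ger0_norm (distr_ge0 p x)) ler_wpM2r ?distr_ge0.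
Qed.

End expectation.

Lemma distr_fin_sum1 (R : realType) (A : finType) (p : distr R A) : \sum_a p a = 1.
Proof.
apply: EFin_inj; rewrite -(distr_sum1 p) esum_finType ?sumEFin// => a.
by rewrite lee_fin distr_ge0.
Qed.

Lemma distr_fin_le1 (R : realType) (A : finType) (p : distr R A) a : p a <= 1.
Proof.
rewrite -(distr_fin_sum1 p) (bigD1 a)//= lerDl.
by apply: sumr_ge0 => b _; exact: distr_ge0.
Qed.

Lemma ler_norm_fin_mean (R : realType) (A : finType) (p : distr R A) (f : A -> R) B :
  (forall a, `|f a| <= B) -> `|\sum_a p a * f a| <= B.
Proof.
move=> fB; apply: (le_trans (ler_norm_sum _ _ _)).
rewrite -[leRHS]mul1r -(distr_fin_sum1 p) mulr_suml; apply: ler_sum => a _.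
by rewrite normrM (ger0_norm (distr_ge0 p a)) ler_wpM2l ?distr_ge0.
Qed.

(** * Discounted sums *)

Section geometric.
Context (R : realType) (g : R).
Hypotheses (g0 : 0 <= g) (g1 : g < 1).

Let normg : `|g| < 1. Proof. by rewrite ger0_norm. Qed.

Lemma rsummable_geo : rsummable (fun n : nat => g ^+ n).
Proof.
apply: rsummable_ge0 => [n|]; first exact: exprn_ge0.
rewrite -nneseries_esumT => [|n]; last by rewrite lee_fin exprn_ge0.
suff -> : (\sum_(i <oo) (g ^+ i)%:E = ((1 - g)^-1)%:E)%E by rewrite ltry.
apply: cvg_lim => //.
have -> : (fun n => \sum_(0 <= i < n) (g ^+ i)%:E)%E = EFin \o series (geometric 1 g).
  by apply/funext => n /=; rewrite sumEFin /series/=; congr EFin; apply: eq_bigr => i _; rewrite mul1r.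
apply: cvg_EFin; first by near=> n.
by have := cvg_geometric_series (a := 1) normg; rewrite mul1r.
Unshelve. all: by end_near. Qed.

Lemma rsum_geo : rsum (fun n : nat => g ^+ n) = (1 - g)^-1.
Proof.
apply: (cvg_unique _ (rsum_nat rsummable_geo)) => //=.
have := cvg_geometric_series (a := 1) normg; rewrite mul1r.
suff -> : geometric 1 g = (fun n => g ^+ n) by [].
by apply/funext => n; rewrite /= mul1r.
Qed.

Lemma rsummable_disc (e : nat -> R) : fbounded e -> rsummable (fun n => g ^+ n * e n).
Proof.
move=> [B eB]; apply: (@le_rsummable _ _ _ (fun n => B * g ^+ n)).
  by move=> n; rewrite normrM mulrC (ger0_norm (exprn_ge0 n g0)) ler_wpM2r ?exprn_ge0.
exact/rsummableZ/rsummable_geo.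
Qed.

Lemma ler_norm_disc (e : nat -> R) B : (forall n, `|e n| <= B) ->
  `|rsum (fun n => g ^+ n * e n)| <= B / (1 - g).
Proof.
move=> eB; rewrite -rsum_geo -rsumZ; last exact: rsummable_geo.
apply: ler_norm_rsum => [|n]; first exact/rsummableZ/rsummable_geo.
by rewrite normrM mulrC (ger0_norm (exprn_ge0 n g0)) ler_wpM2r ?exprn_ge0.
Qed.

Lemma rsum_telescope (e : nat -> R) : fbounded e ->
  rsum (fun n => g ^+ n * (e n - g * e n.+1)) = e 0%N.
Proof.
move=> be; have beS : fbounded (fun n => e n.+1) by have [B eB] := be; exists B.
have s0 := rsummable_disc be.
have s1 : rsummable (fun n => g ^+ n.+1 * e n.+1).
  have -> : (fun n => g ^+ n.+1 * e n.+1) = (fun n => g * (g ^+ n * e n.+1)).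
    by apply/funext => n; rewrite exprS mulrA.
  exact/rsummableZ/rsummable_disc.
transitivity (rsum (fun n => g ^+ n * e n - g ^+ n.+1 * e n.+1)).
  by congr rsum; apply/funext => n; rewrite mulrBr mulrA exprSr.
by rewrite rsumB// (rsum_natS s0 s1) expr0 mul1r addrK.
Qed.

End geometric.

(** * Forward laws, value functions and occupancy *)

Section mdp_theory.
Context (R : realType) (S : choiceType) (A : finType) (M : mdp R S A).
Implicit Types (pi : policy R S A) (p : distr R S) (f : S -> R).
Local Notation g := (gamma M).

Let g0 : 0 <= g. Proof. exact: gamma_ge0. Qed.
Let g1 : g < 1. Proof. exact: gamma_lt1. Qed.
Let g1' : 0 < 1 - g. Proof. by rewrite subr_gt0. Qed.

Definition next_mean pi f (s : S) : R := \sum_a pi s a * mean (trans M s a) f.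

Definition policy_reward pi (s : S) : R := \sum_a pi s a * reward M s a.

Lemma next_mean_bound pi f B : (forall s, `|f s| <= B) -> forall s, `|next_mean pi f s| <= B.
Proof. by move=> fB s; apply: ler_norm_fin_mean => a; exact: ler_norm_mean. Qed.

Lemma next_mean_bounded pi f : fbounded f -> fbounded (next_mean pi f).
Proof. by move=> [B fB]; exists B; exact: next_mean_bound. Qed.

Lemma reward_norm s a : `|reward M s a| <= Rmax M.
Proof. by rewrite ler_norml reward_bound. Qed.

Lemma policy_reward_bound pi s : `|policy_reward pi s| <= Rmax M.
Proof. by apply: ler_norm_fin_mean => a; exact: reward_norm. Qed.

(** Joint mass of a state of law [p] and of its successor under [pi]; [step] is its second
    marginal. *)
Let flow pi p (s s' : S) : R := p s * \sum_a pi s a * trans M s a s'.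

Let flow_ge0 pi p s s' : 0 <= flow pi p s s'.
Proof. by rewrite mulr_ge0 ?distr_ge0// sumr_ge0// => a _; rewrite mulr_ge0 ?distr_ge0. Qed.

Let flow_sum pi p s : (\esum_(s' in [set: S]) (flow pi p s s')%:E = (p s)%:E)%E.
Proof.
have sa a : rsummable (fun s' => pi s a * trans M s a s').
  exact/rsummableZ/rsummable_distr.
rewrite -rsumE//; last by apply: rsummableZ; exact: rsummable_sum.
rewrite /flow rsumZ; last exact: rsummable_sum.
rewrite rsum_sum//; congr EFin; rewrite -[RHS]mulr1 -(distr_fin_sum1 (pi s)).
congr (_ * _); apply: eq_bigr => a _.
by rewrite rsumZ ?rsum_distr ?mulr1//; exact: rsummable_distr.
Qed.

Let flow_total pi p :
  (\esum_(s' in [set: S]) \esum_(s in [set: S]) (flow pi p s s')%:E = 1)%E.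
Proof.
rewrite esum_swap => [|s' s]; last by rewrite lee_fin.
by under eq_esum do rewrite flow_sum; rewrite distr_sum1.
Qed.

Let flow_summable pi p s' : rsummable (flow pi p ^~ s').
Proof.
apply: rsummable_ge0 => //; apply: (@le_lt_trans _ _ 1%E); last exact: ltry.
rewrite -(flow_total pi p).
apply: (@esum_ge_term _ _ (fun s' => \esum_(s in [set: S]) (flow pi p s s')%:E)%E) => y.
by apply: esum_ge0 => s _; rewrite lee_fin.
Qed.

Lemma step_sum1 pi p :
  (\esum_(s' in [set: S]) (rsum (fun s => p s * \sum_a pi s a * trans M s a s'))%:E = 1)%E.
Proof.
rewrite -(flow_total pi p); apply: eq_esum => s' _.
by rewrite -(rsumE (f := flow pi p ^~ s')).
Qed.

Definition step pi p : distr R S :=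
  Distr (fun s' => rsum_ge0 (fun s => flow_ge0 pi p s s')) (step_sum1 pi p).

(** The evolution of laws is adjoint to [next_mean]: both sides integrate [f s'] against [flow], in
    the two orders of summation. *)
Lemma mean_step pi p f : fbounded f -> mean (step pi p) f = mean p (next_mean pi f).
Proof.
move=> bf; have [B fB] := bf; rewrite /mean /step/=.
transitivity (rsum (fun s' => rsum (fun s => flow pi p s s' * f s'))).
  congr rsum; apply/funext => s'; rewrite mulrC -rsumZ//.
  by congr rsum; apply/funext => s; rewrite mulrC.
rewrite rsum_swap; last first.
  apply: (@le_lt_trans _ _ (B%:E * 1)%E); last by rewrite mule1 ltry.
  have B0 : 0 <= B by have [s _] := distr_inhabited (init M); rewrite (le_trans _ (fB s)).
  rewrite -(flow_total pi p) -esumZ ?lee_fin//; last first.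
    by move=> s'; apply: esum_ge0 => s _; rewrite lee_fin.
  apply: le_esum => s' _; rewrite -esumZ ?lee_fin// => [|s]; last by rewrite lee_fin.
  apply: le_esum => s _; rewrite -EFinM lee_fin normrM mulrC.
  by rewrite (ger0_norm (flow_ge0 _ _ _ _)) ler_wpM2r.
congr rsum; apply/funext => s; rewrite /next_mean.
have sa a : rsummable (fun s' => pi s a * (trans M s a s' * f s')).
  by apply/rsummableZ/rsummable_mean.
transitivity (p s * rsum (fun s' => \sum_a pi s a * (trans M s a s' * f s'))).
  rewrite -rsumZ; last exact: rsummable_sum.
  congr rsum; apply/funext => s'; rewrite /flow -mulrA mulr_suml.
  by congr (_ * _); apply: eq_bigr => a _; rewrite mulrA.
congr (_ * _); rewrite rsum_sum//; apply: eq_bigr => a _.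
by rewrite rsumZ//; exact: rsummable_mean.
Qed.

Definition law pi t : distr R S := iter t (step pi) (init M).

Lemma mean_law pi t f : fbounded f -> mean (law pi t) f = mean (init M) (iter t (next_mean pi) f).
Proof.
elim: t f => [//|t ih] f bf; rewrite /law iterS mean_step// -/(law pi t) ih ?iterSr//.
exact: next_mean_bounded.
Qed.

(** The expectation is taken term by term here; for rewards, [expected_return] identifies the result
    with the expectation of the random series. *)
Definition disc_return pi f : R := rsum (fun t => g ^+ t * mean (law pi t) f).

Lemma mean_law_bounded pi f : fbounded f -> fbounded (fun t => mean (law pi t) f).
Proof. by move=> [B fB]; exists B => t; exact: ler_norm_mean. Qed.

(** The mean of [next_mean pi f] at time [t] is the mean of [f] at time [t + 1], so the discounted
    terms telescope. *)
Lemma disc_return_potential pi f : fbounded f ->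
  disc_return pi (fun s => f s - g * next_mean pi f s) = mean (init M) f.
Proof.
move=> bf; have bn := next_mean_bounded pi bf.
rewrite -[RHS](rsum_telescope g0 g1 (mean_law_bounded pi bf)).
congr rsum; apply/funext => t; congr (_ * _).
by rewrite meanB//; [rewrite meanZ// -mean_step|exact: fboundedZ].
Qed.

Lemma disc_returnB pi f h : fbounded f -> fbounded h ->
  disc_return pi (fun s => f s - h s) = disc_return pi f - disc_return pi h.
Proof.
move=> bf bh; rewrite /disc_return -rsumB; do ?exact/rsummable_disc/mean_law_bounded.
by congr rsum; apply/funext => t; rewrite -mulrBr meanB.
Qed.

Lemma iter_next_mean_bound pi f B t : (forall s, `|f s| <= B) ->
  forall s, `|iter t (next_mean pi) f s| <= B.
Proof. by move=> fB; elim: t => // t ih; exact: next_mean_bound. Qed.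

(** [V] is the Neumann series [sum_t g^t T^t f] with [T = next_mean pi]. Its term at 0 is [f], and
    Fubini pulls [T] out of the rest. *)
Lemma bellman pi f B : (forall s, `|f s| <= B) ->
  exists V : S -> R, (forall s, `|V s| <= B / (1 - g)) /\
    (forall s, V s = f s + g * next_mean pi V s).
Proof.
move=> fB; pose u t s := iter t (next_mean pi) f s.
have uB t s : `|u t s| <= B by exact: iter_next_mean_bound.
have ub s : fbounded (u ^~ s) by exists B.
have ubS s : fbounded (fun t => u t.+1 s) by exists B.
pose V s := rsum (fun t => g ^+ t * u t s).
exists V; split=> s; first exact: ler_norm_disc.
have sS : rsummable (fun t => g ^+ t.+1 * u t.+1 s).
  have -> : (fun t => g ^+ t.+1 * u t.+1 s) = (fun t => g * (g ^+ t * u t.+1 s)).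
    by apply/funext => t; rewrite exprS mulrA.
  exact/rsummableZ/rsummable_disc.
rewrite /V (rsum_natS (rsummable_disc g0 g1 (ub s)) sS) expr0 mul1r; congr (_ + _).
transitivity (g * rsum (fun t => g ^+ t * u t.+1 s)).
  rewrite -rsumZ; last exact: rsummable_disc.
  by congr rsum; apply/funext => t; rewrite exprS mulrA.
congr (_ * _); rewrite /next_mean.
have sa a : rsummable (fun t => pi s a * (g ^+ t * mean (trans M s a) (u t))).
  by apply/rsummableZ/rsummable_disc => //; exists B => t; exact: ler_norm_mean.
transitivity (rsum (fun t => \sum_a pi s a * (g ^+ t * mean (trans M s a) (u t)))).
  congr rsum; apply/funext => t; rewrite /u iterS /next_mean mulr_sumr.
  by apply: eq_bigr => a _; rewrite mulrCA.
rewrite rsum_sum//; apply: eq_bigr => a _; rewrite rsumZ; last first.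
  by apply/rsummable_disc => //; exists B => t; exact: ler_norm_mean.
congr (_ * _).
transitivity (rsum (fun t => rsum (fun s' => trans M s a s' * (g ^+ t * u t s')))).
  congr rsum; apply/funext => t; rewrite /mean -rsumZ; last by apply: rsummable_mean; exists B.
  by congr rsum; apply/funext => s'; rewrite mulrCA.
rewrite rsum_swap; last first.
  have B0 : 0 <= B by rewrite (le_trans _ (fB s)).
  apply: (@le_lt_trans _ _ (\esum_(t in [set: nat]) (B * g ^+ t)%:E)%E); last first.
    rewrite -rsumE ?ltry// => [t|]; first by rewrite mulr_ge0 ?exprn_ge0.
    exact/rsummableZ/rsummable_geo.
  apply: le_esum => t _; rewrite -[leRHS]mule1 -(distr_sum1 (trans M s a)) -esumZ; last 2 first.
  - by rewrite lee_fin mulr_ge0 ?exprn_ge0.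
  - by move=> s'; rewrite lee_fin distr_ge0.
  apply: le_esum => s' _; rewrite -EFinM lee_fin !normrM (ger0_norm (distr_ge0 _ _)).
  rewrite mulrC ler_wpM2r ?distr_ge0// mulrC (ger0_norm (exprn_ge0 _ g0)).
  by rewrite ler_wpM2r ?exprn_ge0.
congr rsum; apply/funext => s'; rewrite rsumZ//.
exact: rsummable_disc.
Qed.

(** Joint mass of a geometric time [t] and of the state at that time; summing out [t] gives the
    visitation distribution. *)
Let occ pi (t : nat) (s : S) : R := (1 - g) * (g ^+ t * law pi t s).

Let occ_ge0 pi t s : 0 <= occ pi t s.
Proof. by rewrite !mulr_ge0 ?exprn_ge0 ?distr_ge0// ltW. Qed.

Let occ_total pi : (\esum_(t in [set: nat]) \esum_(s in [set: S]) (occ pi t s)%:E = 1)%E.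
Proof.
transitivity (\esum_(t in [set: nat]) ((1 - g) * g ^+ t)%:E)%E.
  apply: eq_esum => t _; rewrite -[RHS]mule1 -(distr_sum1 (law pi t)) -esumZ; last 2 first.
  - by rewrite lee_fin mulr_ge0 ?exprn_ge0// ltW.
  - by move=> s; rewrite lee_fin distr_ge0.
  by apply: eq_esum => s _; rewrite -EFinM /occ mulrA.
rewrite -rsumE => [|t|]; last 2 first.
- by rewrite mulr_ge0 ?exprn_ge0// ltW.
- exact/rsummableZ/rsummable_geo.
rewrite rsumZ; last exact: rsummable_geo.
by rewrite rsum_geo// divff// gt_eqF.
Qed.

Let occ_summable pi s : rsummable (occ pi ^~ s).
Proof.
apply: rsummable_ge0 => //; apply: (@le_lt_trans _ _ 1%E); last exact: ltry.
rewrite -(occ_total pi) esum_swap => [|t s']; last by rewrite lee_fin.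
apply: (@esum_ge_term _ _ (fun s => \esum_(t in [set: nat]) (occ pi t s)%:E)%E) => y.
by apply: esum_ge0 => t _; rewrite lee_fin.
Qed.

Lemma occupancy_sum1 pi :
  (\esum_(s in [set: S]) (rsum (fun t => (1 - g) * (g ^+ t * law pi t s)))%:E = 1)%E.
Proof.
rewrite -(occ_total pi) esum_swap => [|t s]; last by rewrite lee_fin.
by apply: eq_esum => s _; rewrite -rsumE.
Qed.

Definition occupancy pi : distr R S :=
  Distr (fun s => rsum_ge0 (fun t => occ_ge0 pi t s)) (occupancy_sum1 pi).

Lemma mean_occupancy pi f : fbounded f ->
  mean (occupancy pi) f = (1 - g) * disc_return pi f.
Proof.
move=> bf; have [B fB] := bf; rewrite /mean /occupancy/=.
transitivity (rsum (fun s => rsum (fun t => occ pi t s * f s))).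
  congr rsum; apply/funext => s; rewrite mulrC -rsumZ//.
  by congr rsum; apply/funext => t; rewrite mulrC.
rewrite -rsum_swap; last first.
  apply: (@le_lt_trans _ _ (B%:E * 1)%E); last by rewrite mule1 ltry.
  have B0 : 0 <= B by have [s _] := distr_inhabited (init M); rewrite (le_trans _ (fB s)).
  rewrite -(occ_total pi) -esumZ ?lee_fin//; last first.
    by move=> s'; apply: esum_ge0 => s _; rewrite lee_fin.
  apply: le_esum => t _; rewrite -esumZ ?lee_fin// => [|s]; last by rewrite lee_fin.
  apply: le_esum => s _; rewrite -EFinM lee_fin normrM mulrC.
  by rewrite (ger0_norm (occ_ge0 _ _ _)) ler_wpM2r.
rewrite /disc_return -rsumZ; last exact/rsummable_disc/mean_law_bounded.
congr rsum; apply/funext => t; rewrite mulrA -rsumZ; last exact: rsummable_mean.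
by congr rsum; apply/funext => s; rewrite /occ !mulrA.
Qed.

Lemma performance_difference pi pi' : exists V : S -> R,
  (forall s, `|V s| <= Rmax M / (1 - g)) /\
  (1 - g) * (disc_return pi (policy_reward pi) - disc_return pi' (policy_reward pi')) =
  mean (occupancy pi) (fun s => \sum_a (pi s a - pi' s a) *
     (reward M s a + g * mean (trans M s a) V)).
Proof.
have [V [VB VE]] := bellman pi' (policy_reward_bound pi').
exists V; split=> //.
have bV : fbounded V by exists (Rmax M / (1 - g)).
have br q : fbounded (policy_reward q) by exists (Rmax M); exact: policy_reward_bound.
have bg q : fbounded (fun s => g * next_mean q V s) by exact/fboundedZ/next_mean_bounded.
(* Along [pi'] the reward is the Bellman residual of [V], so the return only sees the initial
   law. *)
have -> : disc_return pi' (policy_reward pi') = mean (init M) V.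
  rewrite -(disc_return_potential pi' bV); congr disc_return.
  by apply/funext => s; rewrite {1}VE addrK.
(* The same initial mean is now expanded along [pi], which puts both returns under the law of one
   process. *)
rewrite -(disc_return_potential pi bV) -disc_returnB//; last exact: fboundedB.
rewrite -mean_occupancy; last by apply: fboundedB => //; exact: fboundedB.
congr mean; apply/funext => s; rewrite {1}VE /policy_reward /next_mean.
rewrite !mulr_sumr -big_split/= -!sumrB; apply: eq_bigr => a _; ring.
Qed.

End mdp_theory.

(** * Law of a trajectory *)

Section discrete_variable.
Context d (U : measurableType d) (R : realType) (P : probability U R).

Lemma bounded_integrable (f : U -> R) (B : R) : measurable_fun setT f ->
  (forall u, `|f u| <= B) -> P.-integrable setT (EFin \o f).
Proof.
move=> mf fB.
apply: (le_integrable measurableT _ _ (finite_measure_integrable_cst P B measurableT)).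
  exact/measurable_EFinP.
by move=> u _; rewrite /= lee_fin (le_trans (fB u))// ler_norm.
Qed.

Context (T : choiceType) (X : U -> T).
Hypothesis mX : forall B, measurable (X @^-1` B).

Lemma measurable_discrete (f : T -> R) : measurable_fun setT (f \o X).
Proof. by move=> _ B mB; rewrite setTI comp_preimage; exact: mX. Qed.

Lemma sum_fibers_le (E : set U) (r : seq T) : measurable E -> uniq r ->
  (\sum_(x <- r) P (E `&` X @^-1` [set x]) <= P E)%E.
Proof.
move=> mE ur; suff -> : (\sum_(x <- r) P (E `&` X @^-1` [set x]) =
    P (E `&` X @^-1` [set` r]))%E.
  by apply: le_measure; rewrite ?inE//; exact: measurableI.
elim: r ur => [_|x r ih /= /andP[xr ur]].
  rewrite big_nil (_ : _ `&` _ = set0) ?measure0//.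
  by apply/seteqP; split=> // u [_ /=].
rewrite big_cons ih// -measureU//; first last.
- apply/seteqP; split=> // u [[_ /= ->]] [_ /= xr'].
  by move: xr; rewrite xr'.
- exact: measurableI.
- exact: measurableI.
congr (P _); apply/seteqP; split=> u /=.
  by move=> [[Eu ->]|[Eu ur']]; split=> //; rewrite in_cons ?eqxx// ur' orbT.
by move=> [Eu]; rewrite in_cons => /orP[/eqP|]; [left|right].
Qed.

Context (w : distr R T).
Hypothesis Xw : forall x, ((w x)%:E <= P (X @^-1` [set x]))%E.

(** Adding [B] makes [f] nonnegative, so its mean is a supremum of finite sums, each bounded by the
    integral of a simple function below [h \o X]. Both [w] and [P] have mass 1, so the shift
    cancels. *)
Let mean_le_integral (f : T -> R) (B : R) : (forall x, `|f x| <= B) ->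
  ((mean w f)%:E <= \int[P]_u (f (X u))%:E)%E.
Proof.
move=> fB; pose h x := f x + B.
have h0 x : 0 <= h x by have := fB x; rewrite ler_norml => /andP[? _]; rewrite /h; lra.
have bf : fbounded f by exists B.
have bc : fbounded (fun _ : T => B) by exists `|B|.
have intf : P.-integrable setT (EFin \o (f \o X)).
  exact: (bounded_integrable (measurable_discrete f) (fun u => fB (X u))).
have mh : measurable_fun setT (EFin \o (h \o X)).
  by apply/measurable_EFinP; exact: measurable_discrete.
suff : (\esum_(x in [set: T]) (w x * h x)%:E <= \int[P]_u (h (X u))%:E)%E.
  rewrite -rsumE; last 2 first.
  - by move=> x; rewrite mulr_ge0 ?distr_ge0.
  - by apply: rsummable_mean; exact: fboundedD.
  rewrite -/(mean w h) meanD// mean_cst.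
  under eq_integral do rewrite EFinD.
  rewrite integralD//; last exact: (finite_measure_integrable_cst P B).
  have -> : (\int[P]__ B%:E = B%:E)%E.
    transitivity (B%:E * P setT)%E; first exact: (integral_cst P measurableT).
    by rewrite probability_setT mule1.
  rewrite EFinD.
  by rewrite leeD2rE.
apply: ge_ereal_sup => _ [F [finF _] <-]; rewrite fsbig_finite//=.
set r := fset_set F.
pose k x (u : U) := ((h x)%:E * (\1_(X @^-1` [set x]) u)%:E)%E.
have k0 x u : (0 <= k x u)%E by rewrite mule_ge0 ?lee_fin.
have mk x : measurable_fun setT (k x).
  by apply: measurable_funeM; apply/measurable_EFinP; apply: measurable_indic; exact: mX.
apply: (@le_trans _ _ (\int[P]_u (\sum_(x <- r) k x u))%E).
  rewrite ge0_integral_sum//; apply: lee_sum => x _.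
  rewrite ge0_integralZl_EFin//; last by apply/measurable_EFinP; apply: measurable_indic.
  rewrite integral_indic// setIT muleC EFinM lee_wpmul2r// lee_fin//.
apply: ge0_le_integral => //.
- by move=> u _; apply: sume_ge0.
- exact: emeasurable_sum.
move=> u _; have [ur|ur] := boolP (X u \in r).
  rewrite (big_fsetD1 (X u))//= big_seq big1 ?adde0.
    by rewrite /k indicE mem_set//= mule1.
  move=> x; rewrite !inE => /andP[xu _].
  by rewrite /k indicE memNset ?mule0//= => /esym/eqP; apply/negP.
rewrite big_seq big1 ?lee_fin// => x xr.
rewrite /k indicE memNset ?mule0//= => E; move: ur; rewrite E xr//.
Qed.

(* As [w] has mass 1, lower bounds on the point masses determine the law of [X]:
   apply the one-sided estimate to [f] and to [- f]. *)
Lemma integral_discrete (f : T -> R) : fbounded f ->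
  (\int[P]_u (f (X u))%:E = (mean w f)%:E)%E.
Proof.
move=> [B fB]; apply/eqP; rewrite eq_le (mean_le_integral fB) andbT.
have fNB x : `|- f x| <= B by rewrite normrN.
have intf : P.-integrable setT (EFin \o (f \o X)).
  exact: (bounded_integrable (measurable_discrete f) (fun u => fB (X u))).
have := mean_le_integral fNB.
under eq_fun do rewrite -mulN1r.
rewrite meanZ; last by exists B.
rewrite mulN1r EFinN.
under eq_integral do rewrite EFinN.
by rewrite integralN ?leeN2// integrable_add_def.
Qed.

End discrete_variable.

(** * Marginal laws of a trajectory and its expected return *)

Section trajectory_law.
Context (R : realType) (S : choiceType) (A : finType) (M : mdp R S A).
Context (pi : policy R S A) (tau : trajectory M pi).
Local Notation g := (gamma M).
Local Notation P := (traj_P tau).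
Local Notation stepv t := (fun w => (state tau t w, action tau t w)).

Let g0 : 0 <= g. Proof. exact: gamma_ge0. Qed.
Let g1 : g < 1. Proof. exact: gamma_lt1. Qed.

Let measurable_step t (B : set (S * A)) : measurable (stepv t @^-1` B).
Proof.
have -> : stepv t @^-1` B = \bigcup_(a in [set: A])
    (state tau t @^-1` [set s | B (s, a)] `&` action tau t @^-1` [set a]).
  apply/seteqP; split=> [w /= Bw|w [a _ [/= Bw aw]]]; last by rewrite aw.
  by exists (action tau t w).
apply: countable_bigcup_measurable.
  exact/finite_set_countable/finite_finset.
by move=> a; apply: measurableI; [exact: state_measurable|exact: action_measurable].
Qed.

Let prefix h : set (traj_space tau) :=
  [set w | mkseq (fun t => (state tau t w, action tau t w)) (size h) = h].

Let prefix_rcons h x : prefix (rcons h x) = prefix h `&` stepv (size h) @^-1` [set x].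
Proof.
apply/seteqP; split=> w; rewrite /prefix/= size_rcons mkseqS.
  by move=> /rcons_inj[hh xx]; split.
by move=> [hh xx]; rewrite hh xx.
Qed.

Let measurable_prefix h : measurable (prefix h).
Proof.
elim/last_ind: h => [|h x ih]; first by rewrite (_ : prefix _ = setT)//; apply/seteqP; split.
by rewrite prefix_rcons; apply: measurableI.
Qed.

(** Conditional law of the state that follows the prefix [h]. *)
Let next_law := fix next_law (p : distr R S) (h : seq (S * A)) : distr R S :=
  if h is (s, a) :: h' then next_law (trans M s a) h' else p.

Let path_prob_rcons (p : distr R S) h s a : path_prob M pi p (rcons h (s, a)) =
  path_prob M pi p h * (next_law p h s * pi s a).
Proof.
elim: h p => [|[s' a'] h ih] p /=; first by rewrite mulr1 mul1r.
by rewrite ih !mulrA.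
Qed.

Let next_law_rcons p h s a : next_law p (rcons h (s, a)) = trans M s a.
Proof. by elim: h p => [//|[s' a'] h ih] p /=. Qed.

Let path_prob_ge0 (p : distr R S) h : 0 <= path_prob M pi p h.
Proof. by elim: h p => [//|[s a] h ih] p /=; rewrite !mulr_ge0 ?distr_ge0. Qed.

(** Conditional probability, given the current state [s], that the current pair is [x]; applying
    [next_mean] [t] times gives that of seeing [x] after [t] steps. *)
Let hit (x : S * A) (s : S) : R := pi s x.2 * (s == x.1)%:R.

Let hit_ge0 x s : 0 <= hit x s. Proof. by rewrite mulr_ge0 ?distr_ge0. Qed.

Let hit_bounded x s : `|hit x s| <= 1.
Proof.
rewrite ger0_norm// /hit; case: eqP => _; rewrite ?mulr0// mulr1.
exact: distr_fin_le1.
Qed.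

Let mean_hit (p : distr R S) x : mean p (hit x) = p x.1 * pi x.1 x.2.
Proof.
rewrite /mean (rsum_pt (x := x.1)) /hit ?eqxx ?mulr1//.
by move=> s /negbTE ->; rewrite !mulr0.
Qed.

Let iter_hit_ge0 x t s : 0 <= iter t (next_mean M pi) (hit x) s.
Proof.
elim: t s => [|t ih] s /=; first exact: hit_ge0.
apply: sumr_ge0 => a _; rewrite mulr_ge0 ?distr_ge0//.
by apply: rsum_ge0 => s'; rewrite mulr_ge0 ?distr_ge0.
Qed.

(** Induction on [t], lengthening the prefix by one pair. Since only a lower bound is claimed, it
    suffices to add up finitely many extensions at a time. *)
Let prefix_le t h x :
  ((path_prob M pi (init M) h *
    mean (next_law (init M) h) (iter t (next_mean M pi) (hit x)))%:E <=
  P (prefix h `&` stepv (size h + t) @^-1` [set x]))%E.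
Proof.
elim: t h => [|t ih] h.
  rewrite addn0 -prefix_rcons mean_hit traj_law; case: x => s a.
  by rewrite path_prob_rcons.
set p := next_law _ h; pose u := iter t (next_mean M pi) (hit x); rewrite iterS -/u.
have uB s : `|u s| <= 1 by apply: iter_next_mean_bound; exact: hit_bounded.
have bn : fbounded (next_mean M pi u) by exists 1; exact: next_mean_bound.
set W := path_prob _ _ _ _.
have n0 s : 0 <= next_mean M pi u s by exact: (iter_hit_ge0 x t.+1).
rewrite /mean -rsumZ; last exact: rsummable_mean.
rewrite rsumE; last 2 first.
- by move=> s; rewrite !mulr_ge0 ?distr_ge0 ?path_prob_ge0.
- exact/rsummableZ/rsummable_mean.
apply: ge_ereal_sup => _ [F [finF _] <-]; rewrite fsbig_finite//=.
set r := fset_set F; set E := prefix h `&` _.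
have mE : measurable E by apply: measurableI.
pose q := [seq (s, a) | s <- r, a <- enum A].
have uq : uniq q by rewrite allpairs_uniq// ?enum_uniq// => -[? ?] [? ?].
apply: (le_trans _ (sum_fibers_le P (measurable_step (size h)) mE uq)).
rewrite big_allpairs; apply: lee_sum => s _; rewrite big_enum/=.
rewrite /next_mean !mulr_sumr -sumEFin; apply: lee_sum => a _.
have := ih (rcons h (s, a)); rewrite next_law_rcons path_prob_rcons -/W -/p -/u.
rewrite (_ : W * (p s * (pi s a * mean (trans M s a) u)) =
  W * (p s * pi s a) * mean (trans M s a) u); last by ring.
(* One more pair in the prefix, one step fewer to go: the time [size h + t.+1] at which [x] is seen
   is unchanged. *)
move=> /le_trans; apply; apply: le_measure; rewrite ?inE; try exact: measurableI.
rewrite prefix_rcons size_rcons addSnnS => w [[hw sw] xw]; split=> //.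
Qed.

Lemma step_law_le t x : ((distr_pair (law M pi t) pi x)%:E <=
  P (stepv t @^-1` [set x]))%E.
Proof.
have := prefix_le t [::] x; rewrite mul1r add0n -mean_law; last first.
  by exists 1; exact: hit_bounded.
rewrite mean_hit; congr (_ <= P _)%E.
by rewrite (_ : prefix _ = setT) ?setTI//; apply/seteqP; split.
Qed.

Lemma mean_pair (p : distr R S) (f : S * A -> R) : fbounded f ->
  mean (distr_pair p pi) f = mean p (fun s => \sum_a pi s a * f (s, a)).
Proof.
move=> [B fB]; have pair_ge0 (x : S * A) : 0 <= distr_pair p pi x by exact: distr_ge0.
have key h : (forall x, 0 <= h x) -> fbounded h ->
    mean (distr_pair p pi) h = mean p (fun s => \sum_a pi s a * h (s, a)).
  move=> h0 bh; have bs : fbounded (fun s => \sum_a pi s a * h (s, a)).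
    by have [C hC] := bh; exists C => s; exact: ler_norm_fin_mean.
  have s0 s : 0 <= \sum_a pi s a * h (s, a).
    by apply: sumr_ge0 => a _; rewrite mulr_ge0 ?distr_ge0.
  apply: EFin_inj; rewrite !rsumE; last 4 first.
  - by move=> s; rewrite mulr_ge0 ?distr_ge0.
  - exact: rsummable_mean.
  - by move=> x; rewrite mulr_ge0.
  - exact: rsummable_mean.
  transitivity (\esum_(x in [set: S] `*`` (fun=> [set: A]))
      (p x.1 * pi x.1 x.2 * h (x.1, x.2))%:E)%E.
    have -> : [set: S] `*`` (fun=> [set: A]) = [set: S * A] by apply/seteqP; split.
    by apply: eq_esum => -[s a] _.
  rewrite -(@esum_esum _ _ _ _ _ (fun s a => (p s * pi s a * h (s, a))%:E)); last first.
    by move=> s a _ _; rewrite lee_fin !mulr_ge0 ?distr_ge0.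
  apply: eq_esum => s _; rewrite esum_finType => [|a]; last by rewrite lee_fin !mulr_ge0 ?distr_ge0.
  by rewrite sumEFin mulr_sumr; congr EFin; apply: eq_bigr => a _; rewrite mulrA.
have fE : f = (fun x => (f x + B) - B) by apply/funext => x; rewrite addrK.
have bf : fbounded f by exists B.
have bB (V : Type) : fbounded (fun _ : V => B) by exists `|B|.
have bfB : fbounded (fun x => f x + B) by exact: fboundedD.
rewrite [in LHS]fE meanB// mean_cst key//; last first.
  by move=> x; have := fB x; rewrite ler_norml => /andP[? _]; lra.
have bS : fbounded (fun s => \sum_a pi s a * (f (s, a) + B)).
  have [C hC] := bfB; exists C => s.
  exact: (ler_norm_fin_mean (pi s) (fun a => hC (s, a))).
rewrite -[X in _ - X](mean_cst p B) -meanB//.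
congr mean; apply/funext => s.
rewrite -[X in _ - X]mul1r -(distr_fin_sum1 (pi s)) mulr_suml -sumrB.
by apply: eq_bigr => a _; rewrite -mulrBr addrK.
Qed.

Lemma integral_step t (f : S * A -> R) : fbounded f ->
  (\int[P]_w (f (state tau t w, action tau t w))%:E =
  (mean (law M pi t) (fun s => \sum_a pi s a * f (s, a)))%:E)%E.
Proof.
by move=> bf; rewrite (integral_discrete (measurable_step t) (step_law_le t) bf) mean_pair.
Qed.

Lemma state_law t s : (P (state tau t @^-1` [set s]) = (law M pi t s)%:E)%E.
Proof.
pose f (x : S * A) : R := (x.1 == s)%:R.
have bf : fbounded f by exists 1 => x; rewrite /f; case: eqP; rewrite ?normr1 ?normr0.
have := integral_step t bf; rewrite /f/=.
have -> : mean (law M pi t) (fun s' => \sum_a pi s' a * (s' == s)%:R) = law M pi t s.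
  rewrite /mean (rsum_pt (x := s)).
    by rewrite -mulr_suml distr_fin_sum1 eqxx !mulr1.
  by move=> s' /negbTE ->; rewrite -mulr_suml !mulr0.
move=> <-; have ms := @state_measurable _ _ _ _ _ tau t [set s].
transitivity (\int[P]_w (\1_(state tau t @^-1` [set s]) w)%:E)%E.
  by rewrite integral_indic ?setIT.
apply: eq_integral => w _; rewrite indicE; congr (_%:R%:E).
by case: eqP => E; [rewrite mem_set|rewrite memNset].
Qed.

(** The partial returns are bounded by [Rmax / (1 - g)], so dominated convergence exchanges
    expectation and limit; each finite stage involves only the laws of single steps. *)
Lemma expected_return :
  ('E_P[fun w => limn (series (fun t => g ^+ t * reward M (state tau t w) (action tau t w)))%R]
  = (disc_return M pi (policy_reward M pi))%:E)%E.
Proof.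
pose u w t := g ^+ t * reward M (state tau t w) (action tau t w).
have br w : fbounded (fun t => reward M (state tau t w) (action tau t w)).
  by exists (Rmax M) => t; exact: reward_norm.
have su w : rsummable (u w) by exact: rsummable_disc.
pose F n w := (series (u w) n)%:E; pose B : R := Rmax M / (1 - g).
have mu t : measurable_fun setT (fun w => u w t).
  exact: (measurable_discrete (measurable_step t) (fun x => g ^+ t * reward M x.1 x.2)).
have mF n : measurable_fun setT (F n).
  apply/measurable_EFinP; rewrite /series/=.
  by apply: measurable_sum => t; exact: mu.
have Fcv w : setT w -> F ^~ w @ \oo --> (limn (series (u w)))%:E.
  move=> _; apply: cvg_EFin; first by near=> n.
  by rewrite (cvg_lim _ (rsum_nat (su w)))//; exact: rsum_nat.
have ub t w : `|u w t| <= g ^+ t * Rmax M.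
  by rewrite /u normrM (ger0_norm (exprn_ge0 _ g0)) ler_wpM2l ?exprn_ge0 ?reward_norm.
have R0 : 0 <= Rmax M.
  have [s _] := distr_inhabited (init M); have [a _] := distr_inhabited (pi s).
  exact: le_trans (reward_norm M s a).
have Fb w n : setT w -> (`|F n w| <= B%:E)%E.
  move=> _; rewrite /F/= lee_fin /series/=; apply: le_trans (ler_norm_sum _ _ _) _.
  have le_geo : \sum_(0 <= t < n) `|u w t| <= \sum_(0 <= t < n) g ^+ t * Rmax M.
    by apply: ler_sum => t _; exact: ub.
  apply: le_trans le_geo _.
  rewrite -mulr_suml mulrC ler_wpM2l// -rsum_geo// -lee_fin rsumE; last 2 first.
  - by move=> t; exact: exprn_ge0.
  - exact: rsummable_geo.
  rewrite -sumEFin -nneseries_esumT; last by move=> t; rewrite lee_fin exprn_ge0.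
  by apply: nneseries_lim_ge => t _ _; rewrite lee_fin exprn_ge0.
have mlim : measurable_fun setT (fun w => (limn (series (u w)))%:E).
  exact: emeasurable_fun_cvg mF Fcv.
have [_ _ cv] := @dominated_convergence _ _ _ P setT measurableT F _ (cst B%:E) mF mlim
  (aeW _ Fcv) (finite_measure_integrable_cst P B measurableT) (aeW _ Fb).
rewrite unlock; apply: (cvg_unique _ cv) => //=.
have bm : fbounded (fun t => mean (law M pi t) (policy_reward M pi)).
  by apply: mean_law_bounded; exists (Rmax M); exact: policy_reward_bound.
have cv' := rsum_nat (rsummable_disc g0 g1 bm).
rewrite (_ : (fun n => _) = EFin \o series (fun t => g ^+ t * mean (law M pi t) (policy_reward M pi))).
  by apply: cvg_EFin cv'; near=> n.
apply/funext => n /=; rewrite /F /series/=.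
under eq_integral do rewrite -sumEFin.
rewrite integral_sum//; last first.
  move=> t; apply: (@bounded_integrable _ _ _ P _ (g ^+ t * Rmax M)); first exact: mu.
  exact: ub.
rewrite -sumEFin; apply: eq_bigr => t _; rewrite /u.
rewrite (integral_step t (f := fun x => g ^+ t * reward M x.1 x.2)); last first.
  by exists (g ^+ t * Rmax M) => x; rewrite normrM (ger0_norm (exprn_ge0 _ g0)) ler_wpM2l ?exprn_ge0 ?reward_norm.
congr EFin; rewrite -meanZ; last by exists (Rmax M); exact: policy_reward_bound.
congr mean; apply/funext => s; rewrite /policy_reward mulr_sumr.
by apply: eq_bigr => a _ /=; rewrite mulrCA.
Unshelve. all: by end_near. Qed.

End trajectory_law.

Section perf_visitation.
Context (R : realType) (S : choiceType) (A : finType) (M : mdp R S A).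
Context (pi : policy R S A).

Lemma J_perfE : J_perf M pi = (disc_return M pi (policy_reward M pi))%:E.
Proof. exact: expected_return. Qed.

Lemma visitationE : visitation M pi = occupancy M pi.
Proof.
apply/funext => s; rewrite /visitation/=.
have bl : fbounded (fun t => law M pi t s).
  exists 1 => t; rewrite ger0_norm ?distr_ge0// -lee_fin -(distr_sum1 (law M pi t)).
  by apply: (@esum_ge_term _ _ (fun x => (law M pi t x)%:E)) => x; rewrite lee_fin distr_ge0.
have sl := rsummable_disc (gamma_ge0 M) (gamma_lt1 M) bl.
rewrite rsumZ//; congr (_ * _); rewrite (_ : (fun t => _) = (fun t => gamma M ^+ t * law M pi t s)).
  by apply: cvg_lim => //; exact: rsum_nat.
by apply/funext => t; rewrite state_law.
Qed.

End perf_visitation.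

(** * Model errors and latent policies *)

Section change_of_measure.
Context (R : realType).
Local Open Scope ereal_scope.

(** For a family that is not summable the right-hand side is [+oo], so the bound feeds directly into
    estimates by possibly infinite divergences. *)
Lemma norm_rsum_le (T : choiceType) (f : T -> R) :
  `|rsum f|%:E <= \esum_(x in [set: T]) `|f x|%:E.
Proof.
have [sf|] := ltP (\esum_(x in [set: T]) `|f x|%:E) +oo; last first.
  by rewrite leye_eq => /eqP ->; rewrite leey.
have sf' : rsummable f by [].
rewrite -(@rsumE _ _ (fun x => `|f x|%R))//; last exact: rsummable_norm.
by rewrite lee_fin; apply: ler_norm_rsum => //; exact: rsummable_norm.
Qed.

Lemma norm_meanB_le (T : choiceType) (p q : distr R T) (f : T -> R) (B : R) :
  (forall x, `|f x| <= B)%R ->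
  `|mean p f - mean q f|%:E <= B%:E * \esum_(x in [set: T]) `|p x - q x|%:E.
Proof.
move=> fB; have bf : fbounded f by exists B.
have B0 : (0 <= B)%R by have [s _] := distr_inhabited p; exact: le_trans (fB s).
rewrite /mean -rsumB; do ?exact: rsummable_mean.
apply: le_trans (norm_rsum_le _) _.
rewrite -esumZ ?lee_fin//.
apply: le_esum => s _; rewrite -EFinM lee_fin -mulrBl normrM mulrC.
by rewrite ler_wpM2r.
Qed.

Lemma norm_mean_le (T : choiceType) (p : distr R T) (f : T -> R) :
  fbounded f -> `|mean p f|%:E <= \esum_(x in [set: T]) (p x)%:E * `|f x|%:E.
Proof.
move=> bf; apply: le_trans (norm_rsum_le _) _; apply: le_esum => x _.
by rewrite -EFinM lee_fin normrM (ger0_norm (distr_ge0 p x)).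
Qed.

(** The two parts of [p <= q + |p - q|] give the summands 1 and [sqrte (D_chi2 p q)]: Jensen's
    inequality under [q] for the first, and for the second the factorization [|p - q| sqrt f = sqrt
    ((p - q)^2 / q) * sqrt (q f)]. *)
Lemma esum_change_of_measure (T : choiceType) (p q : distr R T) (f : T -> \bar R) :
  (forall x, 0 < p x -> 0 < q x)%R -> (forall x, 0 <= f x) ->
  \esum_(x in [set: T]) (p x)%:E * sqrte (f x) <=
  (1 + sqrte (D_chi2 p q)) * sqrte (\esum_(x in [set: T]) (q x)%:E * f x).
Proof.
move=> pq f0.
have p0 x : 0 <= (p x)%:E by rewrite lee_fin distr_ge0.
have q0 x : 0 <= (q x)%:E by rewrite lee_fin distr_ge0.
rewrite ge0_muleDl ?sqrte_ge0// mul1e.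
apply: (@le_trans _ _ (\esum_(x in [set: T])
    ((q x)%:E * sqrte (f x) + `|p x - q x|%:E * sqrte (f x)))).
  apply: le_esum => x _; rewrite -ge0_muleDl//; apply: lee_wpmul2r; first exact: sqrte_ge0.
  by rewrite -EFinD lee_fin -lerBlDl ler_norm.
rewrite esumD; [|by move=> x _; rewrite mule_ge0 ?sqrte_ge0// lee_fin..].
apply: leeD.
  apply: esum_sqrt_le => //; by rewrite distr_sum1.
apply: esum_cauchy_schwarz.
- by move=> x; rewrite mule_ge0 ?lee_fin ?sqr_ge0// inve_ge0.
- by move=> x; rewrite mule_ge0.
- by move=> x; rewrite mule_ge0 ?sqrte_ge0.
(* Where [q] vanishes the factorization breaks down, but [p] vanishes too by absolute continuity and
   the left-hand side is 0. *)
move=> x; have [qx|qx] := eqVneq (q x) 0%R.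
  have -> : p x = 0%R.
    apply/eqP; rewrite eq_le distr_ge0 andbT leNgt; apply/negP => /pq.
    by rewrite qx ltxx.
  by rewrite qx subrr normr0 mul0e mule_ge0 ?sqrte_ge0.
rewrite -sqrteM; last by rewrite mule_ge0 ?lee_fin ?sqr_ge0// inve_ge0.
have -> : ((p x - q x) ^+ 2)%:E / (q x)%:E * ((q x)%:E * f x) = ((p x - q x) ^+ 2)%:E * f x.
  by rewrite inver (negbTE qx) muleA -!EFinM divfK.
by rewrite sqrteM ?lee_fin ?sqr_ge0//= sqrtr_sqr.
Qed.

Lemma sum_sqrt_le_unif (A : finType) (f : A -> \bar R) : (0 < #|A|)%N ->
  (forall a, 0 <= f a) ->
  \sum_a sqrte (f a) <= #|A|%:R%:E * sqrte (expect (@unif R A) f).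
Proof.
move=> A0 f0; have Ap : (0 < #|A|%:R :> R)%R by rewrite ltr0n.
have u0 a : (0 <= @unif R A a)%R by rewrite /unif invr_ge0 ltW.
have u1 : \esum_(a in [set: A]) (@unif R A a)%:E = 1.
  rewrite esum_finType => [|a]; last by rewrite lee_fin.
  rewrite sumEFin sumr_const /unif -[(_ *+ _)%R]mulr_natl; congr EFin.
  by apply: mulfV; rewrite gt_eqF.
rewrite expect_ge0E//.
apply: (@le_trans _ _ (#|A|%:R%:E * \esum_(a in [set: A]) (@unif R A a)%:E * sqrte (f a))).
  rewrite -esumZ ?lee_fin//; last by move=> a; rewrite mule_ge0 ?lee_fin ?sqrte_ge0.
  rewrite esum_finType; last by move=> a; rewrite !mule_ge0 ?lee_fin ?sqrte_ge0.
  apply: lee_sum => a _; rewrite muleA -EFinM divff ?gt_eqF// mul1e//.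
by apply: lee_wpmul2l; rewrite ?lee_fin//; apply: esum_sqrt_le => //; rewrite u1.
Qed.

End change_of_measure.

(** Summand of the Shannon entropy; the product makes it 0 at [x = 0], whatever [ln 0] is. *)
Definition neg_xlnx (R : realType) (x : R) : R := - (x * ln x).

(** * Averaging over the fibers of [phi] *)

Section latent.
Context (R : realType) (S Z : choiceType) (A : finType) (M : mdp R S A) (phi : S -> Z).
Context (pi : policy R S A).
Local Notation d := (occupancy M pi).

Let ind (z : Z) (s : S) : R := (phi s == z)%:R.

(** Fiber sums become sums over all of [S] weighted by an indicator, to which linearity and Fubini
    apply. *)
Let fiber_sum (f : S -> R) z : (forall s, 0 <= f s) ->
  fine (\esum_(s in phi @^-1` [set z]) (f s)%:E)%E = rsum (fun s => ind z s * f s).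
Proof.
move=> f0; rewrite /rsum usum_ge0 => [|s]; last by rewrite lee_fin mulr_ge0.
rewrite esum_mkcond; congr fine; apply: eq_esum => s _; rewrite /ind /=.
by case: eqP => E; [rewrite mem_set ?mul1r|rewrite memNset ?mul0r].
Qed.

(** Mass of the pair [(z, a)] when [s] has law [d], [z = phi s] and [a] has law [pi s]. Unlike the
    quotient [latent_policy], it needs no convention on fibers of mass 0. *)
Let joint z a : R := rsum (fun s => ind z s * (d s * pi s a)).

Let dZ z : R := visitationZ M phi pi z.

Let dZE z : dZ z = rsum (fun s => ind z s * d s).
Proof. by rewrite /dZ /visitationZ visitationE fiber_sum// => s; exact: distr_ge0. Qed.

Let ind_summable z (f : S -> R) : rsummable f -> rsummable (fun s => ind z s * f s).
Proof.
move=> sf; apply: le_rsummable (rsummable_norm sf) => s.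
by rewrite normrM /ind; case: eqP; rewrite ?normr1 ?mul1r ?normr0 ?mul0r.
Qed.

Let sd : rsummable d. Proof. exact: rsummable_distr. Qed.

Let sdpi a : rsummable (fun s => d s * pi s a).
Proof. by apply: rsummable_mean; exists 1 => s; rewrite ger0_norm ?distr_ge0 ?distr_fin_le1. Qed.

Let joint_ge0 z a : 0 <= joint z a.
Proof. by apply: rsum_ge0 => s; rewrite !mulr_ge0 ?distr_ge0. Qed.

Let dZ_ge0 z : 0 <= dZ z.
Proof. by rewrite dZE; apply: rsum_ge0 => s; rewrite mulr_ge0 ?distr_ge0. Qed.

Let sum_joint z : \sum_a joint z a = dZ z.
Proof.
rewrite dZE -rsum_sum => [|a]; last exact: ind_summable.
congr rsum; apply/funext => s; rewrite -mulr_sumr -mulr_sumr.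
by rewrite distr_fin_sum1 mulr1.
Qed.

Let sum_dZ : (\esum_(z in [set: Z]) (dZ z)%:E = 1)%E.
Proof.
transitivity (\esum_(z in [set: Z]) \esum_(s in [set: S]) (ind z s * d s)%:E)%E.
  apply: eq_esum => z _; rewrite dZE rsumE//; first by move=> s; rewrite mulr_ge0 ?distr_ge0.
  exact: ind_summable.
rewrite -(distr_sum1 d) (esum_fiber phi) => [|s]; last by rewrite lee_fin distr_ge0.
apply: eq_esum => z _; rewrite [RHS]esum_mkcond; apply: eq_esum => s _; rewrite /ind.
by case: eqP => E; [rewrite mem_set ?mul1r|rewrite memNset ?mul0r].
Qed.

Let latentE z a : latent_policy M phi pi z a = joint z a / dZ z.
Proof.
rewrite /latent_policy visitationE fiber_sum// => s.
by rewrite mulr_ge0 ?distr_ge0.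
Qed.

Let joint_eq0 z a : dZ z = 0 -> joint z a = 0.
Proof.
rewrite -sum_joint => /eqP; rewrite psumr_eq0 => [/allP/(_ a)|b _]; last exact: joint_ge0.
by rewrite mem_index_enum => /(_ isT)/eqP.
Qed.

Let dZ_latent z a : dZ z * latent_policy M phi pi z a = joint z a.
Proof.
have [z0|z0] := eqVneq (dZ z) 0; first by rewrite z0 mul0r joint_eq0.
by rewrite latentE mulrC divfK.
Qed.

Let latent_ge0 z a : 0 <= latent_policy M phi pi z a.
Proof. by rewrite latentE divr_ge0. Qed.

Let latent_sum1 z : dZ z != 0 ->
  (\esum_(a in [set: A]) (latent_policy M phi pi z a)%:E = 1)%E.
Proof.
move=> z0; rewrite esum_finType => [|a]; last by rewrite lee_fin.
rewrite sumEFin; under eq_bigr do rewrite latentE.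
by rewrite -mulr_suml sum_joint divff.
Qed.

Let latent_le1 z a : latent_policy M phi pi z a <= 1.
Proof.
have [z0|z0] := eqVneq (dZ z) 0; first by rewrite latentE joint_eq0// mul0r.
rewrite -lee_fin -(latent_sum1 z0).
by apply: (@esum_ge_term _ _ (fun a => (latent_policy M phi pi z a)%:E)) => b; rewrite lee_fin.
Qed.

Let latent_D_KL0 z q : dZ z = 0 -> D_KL (latent_policy M phi pi z) q = 0%E.
Proof.
move=> z0; rewrite /D_KL /expect usum_ge0 ?esum1// => a; rewrite latentE joint_eq0// mul0r mul0e//.
Qed.

Let neg_xlnx_ge0 z a : 0 <= neg_xlnx (latent_policy M phi pi z a).
Proof. by rewrite oppr_ge0 mulr_ge0_le0// ln_le0. Qed.

(** From [ln (p^-1) <= p^-1 - 1] one gets [- p ln p <= 1 - p]. *)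
Let neg_xlnx_le1 z a : neg_xlnx (latent_policy M phi pi z a) <= 1.
Proof.
rewrite /neg_xlnx; have := latent_ge0 z a; set p := latent_policy M phi pi z a => p0.
have [->|pn] := eqVneq p 0; first by rewrite mul0r oppr0.
have pp : 0 < p by rewrite lt_neqAle eq_sym pn.
have pV : -1 < p^-1 - 1 by rewrite ltrBrDr addNr invr_gt0.
have := le_ln1Dx pV; rewrite addrC subrK lnV ?posrE// => h.
have := ler_wpM2l (ltW pp) h; rewrite mulrN mulrBr mulr1 divff// => h2; lra.
Qed.

(** Conditional entropy of the target's action given [phi s]; its opposite is the [const] of the
    theorem. *)
Definition latent_entropy : \bar R :=
  (\esum_(z in [set: Z]) (visitationZ M phi pi z)%:E *
    (\sum_a neg_xlnx (latent_policy M phi pi z a))%:E)%E.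

(** The crude bound 1 per summand gives at most [#|A|]. Finiteness allows the entropy to be moved
    across equations whose other terms may be [+oo]. *)
Lemma latent_entropy_fin : latent_entropy \is a fin_num.
Proof.
have H0 z : 0 <= \sum_a neg_xlnx (latent_policy M phi pi z a) by apply: sumr_ge0.
rewrite ge0_fin_numE; last by apply: esum_ge0 => z _; rewrite mule_ge0 ?lee_fin.
apply: (@le_lt_trans _ _ (#|A|%:R%:E * 1)%E); last by rewrite mule1 ltry.
rewrite -sum_dZ -esumZ ?lee_fin//; apply: le_esum => z _.
rewrite muleC lee_wpmul2r ?lee_fin//.
apply: (@le_trans _ _ (\sum_(a : A) 1)); first by apply: ler_sum.
by rewrite sumr_const.
Qed.

Context (piZ : policy R Z A).

Let latent_D_KL_ge0 z : (0 <= D_KL (latent_policy M phi pi z) (piZ z))%E.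
Proof.
have [z0|z0] := eqVneq (dZ z) 0; first by rewrite latent_D_KL0.
by apply: D_KL_ge0; rewrite ?latent_sum1 ?distr_sum1// => a; exact: distr_ge0.
Qed.

Lemma latent_KL_esum : (latent_KL M phi pi piZ =
  \esum_(z in [set: Z]) (visitationZ M phi pi z)%:E *
    D_KL (latent_policy M phi pi z) (piZ z))%E.
Proof. by rewrite /latent_KL expect_ge0E. Qed.

(* A reward-like function of [phi s] only sees the policy through its
   conditional mean given [phi s]. *)
Lemma latent_advantage (Q : Z -> A -> R) (K : R) : (forall z a, `|Q z a| <= K) ->
  (`|mean d (fun s => \sum_a (pi s a - piZ (phi s) a) * Q (phi s) a)|%:E <=
  (2 * K)%:E * sqrte (2^-1%:E * latent_KL M phi pi piZ))%E.
Proof.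
move=> QK.
have K0 : 0 <= K.
  have [s _] := distr_inhabited (init M); have [a _] := distr_inhabited (pi s).
  exact: le_trans (QK (phi s) a).
pose F s := d s * \sum_a (pi s a - piZ (phi s) a) * Q (phi s) a.
have sF : rsummable F.
  apply: rsummable_mean; exists (K + K) => s.
  rewrite (eq_bigr (fun a => pi s a * Q (phi s) a - piZ (phi s) a * Q (phi s) a)); last first.
    by move=> a _; rewrite mulrBl.
  rewrite sumrB (le_trans (ler_normB _ _))// lerD//; exact: ler_norm_fin_mean.
(* By [dZ_latent], the coefficient of [Q z a] is [dZ z] times the gap between the latent target
   policy and [piZ]. *)
pose G z := \sum_a (joint z a - dZ z * piZ z a) * Q z a.
have GE z : rsum (fun s => ind z s * F s) = G z.
  have s1 a : rsummable (fun s => ind z s * (d s * pi s a)) by exact: ind_summable.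
  have s2 : rsummable (fun s => ind z s * d s) by exact: ind_summable.
  have s3 a : rsummable (fun s => Q z a * (ind z s * (d s * pi s a) - piZ z a * (ind z s * d s))).
    by apply: rsummableZ; apply: rsummableB => //; exact: rsummableZ.
  transitivity (rsum (fun s => \sum_a Q z a * (ind z s * (d s * pi s a) - piZ z a * (ind z s * d s)))).
    congr rsum; apply/funext => s; rewrite /F !mulr_sumr; apply: eq_bigr => a _.
    by rewrite /ind; case: eqP => [->|_]; rewrite ?(mul1r, mul0r); ring.
  rewrite rsum_sum//; apply: eq_bigr => a _.
  rewrite rsumZ; last by apply: rsummableB => //; exact: rsummableZ.
  rewrite rsumB//; last exact: rsummableZ.
  by rewrite rsumZ// -dZE -/(joint z a) mulrC [dZ z * _]mulrC.
have -> : mean d (fun s => \sum_a (pi s a - piZ (phi s) a) * Q (phi s) a) = rsum G.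
  transitivity (rsum (fun s => rsum (fun z => ind z s * F s))).
    congr rsum; apply/funext => s; rewrite -/(F s) (rsum_pt (x := phi s)) /ind ?eqxx ?mul1r//.
    by move=> z zs; rewrite eq_sym (negbTE zs) mul0r.
  rewrite rsum_swap; first by congr rsum; apply/funext => z; exact: GE.
  apply: le_lt_trans sF; apply: le_esum => s _; rewrite (@esum_pt _ _ _ (phi s)) ?lee_fin//.
    by rewrite /ind eqxx mul1r.
  by move=> z zs; rewrite /ind eq_sym (negbTE zs) mul0r normr0.
apply: le_trans (norm_rsum_le _) _.
apply: (@le_trans _ _ (\esum_(z in [set: Z]) (2 * K)%:E *
    ((dZ z)%:E * sqrte (2^-1%:E * D_KL (latent_policy M phi pi z) (piZ z))))%E).
  apply: le_esum => z _.
  (* Pinsker's inequality needs a distribution, so fibers of mass 0 are settled apart. *)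
  have [z0|z0] := eqVneq (dZ z) 0.
    rewrite z0 mul0e mule0 /G big1 ?normr0// => a _.
    by rewrite z0 joint_eq0// mul0r subrr mul0r.
  have psk : (\esum_(a in [set: A]) `|latent_policy M phi pi z a - piZ z a|%:E <=
      2%:E * sqrte (2^-1%:E * D_KL (latent_policy M phi pi z) (piZ z)))%E.
    by apply: pinsker; rewrite ?latent_sum1 ?distr_sum1// => a; exact: distr_ge0.
  apply: (@le_trans _ _ ((K * dZ z)%:E *
      \esum_(a in [set: A]) `|latent_policy M phi pi z a - piZ z a|%:E)%E).
    rewrite esum_finType => [|a]; last by rewrite lee_fin.
    rewrite sumEFin -EFinM lee_fin mulr_sumr; apply: le_trans (ler_norm_sum _ _ _) _.
    apply: ler_sum => a _; rewrite -dZ_latent -mulrBr !normrM (ger0_norm (dZ_ge0 z)).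
    by rewrite mulrC -mulrA ler_wpM2r// mulr_ge0.
  apply: le_trans (lee_wpmul2l _ psk) _; first by rewrite lee_fin mulr_ge0.
  by rewrite !muleA -!EFinM (_ : K * dZ z * 2 = 2 * K * dZ z)//; ring.
rewrite esumZ ?lee_fin ?mulr_ge0//; last by move=> z; rewrite mule_ge0 ?lee_fin ?sqrte_ge0.
apply: lee_wpmul2l; first by rewrite lee_fin mulr_ge0.
(* Jensen's inequality over [z], the fiber masses summing to 1, brings the mean divergence under the
   root. *)
apply: le_trans (esum_sqrt_le _ _ _) _ => //.
- by rewrite sum_dZ.
- by move=> z; rewrite mule_ge0// lee_fin.
rewrite latent_KL_esum -esumZ ?lee_fin//; last by move=> z; rewrite mule_ge0// lee_fin.
rewrite lee_sqrt; last by apply: esum_ge0 => z _; rewrite !mule_ge0 ?lee_fin.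
by apply: le_esum => z _; rewrite muleCA.
Qed.


Let cross_entropy z : \bar R :=
  (\sum_a (latent_policy M phi pi z a)%:E * - lne (piZ z a)%:E)%E.

Let lnpiZ_ge0 z a : (0 <= - lne (piZ z a)%:E)%E.
Proof.
by rewrite oppe_ge0 lne_le0 lee_fin distr_fin_le1.
Qed.

(** Written as a sum because divergence and cross entropy are both [+oo] when [piZ z] vanishes at an
    action of positive latent probability. The negative parts of the divergence are finite and can
    be cancelled. *)
Let D_KL_entropy z : (D_KL (latent_policy M phi pi z) (piZ z) +
  (\sum_a neg_xlnx (latent_policy M phi pi z a))%:E = cross_entropy z)%E.
Proof.
pose f a := ((latent_policy M phi pi z a)%:E *
  (lne (latent_policy M phi pi z a)%:E - lne (piZ z a)%:E))%E.
have key a : ((maxe (f a) 0 + (neg_xlnx (latent_policy M phi pi z a))%:E =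
    (latent_policy M phi pi z a)%:E * - lne (piZ z a)%:E + maxe (- f a) 0) /\
    (maxe (- f a) 0 \is a fin_num))%E.
  rewrite /f /neg_xlnx; have := latent_ge0 z a; set p := latent_policy M phi pi z a => p00.
  have [->|p0] := eqVneq p 0; first by rewrite !mul0e mul0r oppr0 oppe0 maxxx !adde0.
  have pp : 0 < p by rewrite lt_neqAle eq_sym p0.
  have [->|q0] := eqVneq (piZ z a) 0.
    rewrite lne_EFin// (le0_lneNy (x := 0%:E))//= addey//.
    by rewrite gt0_muley ?lte_fin//= maxye maxNye addye// adde0.
  have qp : 0 < piZ z a by rewrite lt_neqAle eq_sym q0 distr_ge0.
  rewrite !lne_EFin// -EFinB -EFinM -!EFinN -EFinM -!EFin_max -!EFinD; split=> //.
  congr EFin; have [u0|u0] := leP 0 (p * (ln p - ln (piZ z a))).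
    by rewrite (max_idPr _) ?oppr_le0//; ring.
  by rewrite (max_idPl _) ?oppr_ge0 1?ltW//; ring.
have maxf0 (x : \bar R) : (0 <= maxe x 0)%E by rewrite le_max lexx orbT.
rewrite /D_KL /expect /usum; rewrite !esum_finType //.
have fn : (\sum_a f^\- a \is a fin_num)%E.
  by apply/sum_fin_numP => a _ _; rewrite funenegE; have [_ ->] := key a.
have E : (\sum_a f^\+ a + (\sum_a neg_xlnx (latent_policy M phi pi z a))%:E = cross_entropy z + \sum_a f^\- a)%E.
  rewrite -sumEFin -!big_split/=; apply: eq_bigr => a _.
  by rewrite funeposE funenegE; have [-> _] := key a.
by rewrite addeAC E addeK.
Qed.

(** The loss of an action depends on [s] only through [phi s], so grouping the states by fiber
    replaces [d s * pi s a] by [joint z a], which is [dZ z] times the latent policy. *)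
Let J_BCE : (J_BC M phi pi piZ = \esum_(z in [set: Z]) (dZ z)%:E * cross_entropy z)%E.
Proof.
rewrite /J_BC visitationE expect_ge0E; last 2 first.
- by move=> s; exact: distr_ge0.
- move=> s; rewrite expect_ge0E//; last by move=> a; exact: distr_ge0.
  by apply: esum_ge0 => a _; rewrite mule_ge0 ?lee_fin ?distr_ge0.
pose c s := (\sum_a (pi s a)%:E * - lne (piZ (phi s) a)%:E)%E.
have c0 s : (0 <= c s)%E by apply: sume_ge0 => a _; rewrite mule_ge0 ?lee_fin ?distr_ge0.
transitivity (\esum_(s in [set: S]) (d s)%:E * c s)%E.
  apply: eq_esum => s _; rewrite expect_ge0E//; last by move=> a; exact: distr_ge0.
  by rewrite esum_finType// => a; rewrite mule_ge0 ?lee_fin ?distr_ge0.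
rewrite (esum_fiber phi) => [|s]; last by rewrite mule_ge0 ?lee_fin ?distr_ge0.
apply: eq_esum => z _; rewrite esum_mkcond.
transitivity (\esum_(s in [set: S]) \sum_a
    (- lne (piZ z a)%:E) * (ind z s * (d s * pi s a))%:E)%E.
  apply: eq_esum => s _; rewrite /ind; case: (eqVneq (phi s) z) => [E|E].
    rewrite mem_set// /c E ge0_sume_distrr => [|a _]; last by rewrite mule_ge0 ?lee_fin ?distr_ge0.
    by apply: eq_bigr => a _; rewrite mul1r EFinM muleA muleC.
  rewrite memNset; last by move=> /= E'; rewrite E' eqxx in E.
  by rewrite big1// => a _; rewrite mul0r mule0.
rewrite esum_sum => [|s a _ _]; last by rewrite mule_ge0 ?lee_fin ?mulr_ge0 ?distr_ge0.
rewrite /cross_entropy ge0_sume_distrr => [|a _]; last by rewrite mule_ge0 ?lee_fin.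
apply: eq_bigr => a _; rewrite esumZ//; last by move=> s; rewrite lee_fin !mulr_ge0 ?distr_ge0.
rewrite muleA -EFinM dZ_latent muleC; congr (_ * _)%E.
rewrite -rsumE//; last exact: ind_summable.
by move=> s; rewrite !mulr_ge0 ?distr_ge0.
Qed.

(** Averaging [D_KL_entropy] over [z] makes the loss the sum of divergence and entropy; the finite
    entropy is then subtracted, even from an infinite loss. *)
Lemma latent_KL_J_BC : latent_KL M phi pi piZ = ((- fine latent_entropy)%:E + J_BC M phi pi piZ)%E.
Proof.
have H0 z : 0 <= \sum_a neg_xlnx (latent_policy M phi pi z a) by apply: sumr_ge0.
have E : J_BC M phi pi piZ = (latent_KL M phi pi piZ + latent_entropy)%E.
  rewrite J_BCE latent_KL_esum -esumD; last 2 first.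
  - by move=> z _; rewrite mule_ge0 ?lee_fin.
  - by move=> z _; rewrite mule_ge0 ?lee_fin.
  by apply: eq_esum => z _; rewrite -D_KL_entropy ge0_muleDr ?lee_fin ?sumr_ge0.
by rewrite E EFinN fineK ?latent_entropy_fin// addeC addeK// latent_entropy_fin.
Qed.

End latent.

(** * Assembly of the performance bound *)

Section imitation_bound.
Context (R : realType) (S Z : choiceType) (A : finType) (M : mdp R S A).
Context (pi : policy R S A) (phi : S -> Z) (doff : distr R S) (RZ : Z -> A -> R).
Context (PZ : Z -> A -> distr R S) (piZ : policy R Z A).
Hypothesis doffP : forall s, 0 < occupancy M pi s -> 0 < doff s.
Hypothesis RZ_bound : forall z a, - Rmax M <= RZ z a <= Rmax M.
Local Notation g := (gamma M).
Local Notation d := (occupancy M pi).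
Local Notation chi := (1 + sqrte (D_chi2 d doff))%E.

Let g0 : 0 <= g. Proof. exact: gamma_ge0. Qed.
Let g1 : 0 < 1 - g. Proof. by rewrite subr_gt0 gamma_lt1. Qed.

Let A_gt0 : (0 < #|A|)%N.
Proof.
have [s _] := distr_inhabited (init M); have [a _] := distr_inhabited (pi s).
by apply/card_gt0P; exists a.
Qed.

Let Rmax_ge0 : 0 <= Rmax M.
Proof.
have [s _] := distr_inhabited (init M); have [a _] := distr_inhabited (pi s).
exact: le_trans (reward_norm M s a).
Qed.

Let policy_gap s a : `|pi s a - piZ (phi s) a| <= 1.
Proof.
have := distr_fin_le1 (pi s) a; have := distr_fin_le1 (piZ (phi s)) a.
have := distr_ge0 (pi s) a; have := distr_ge0 (piZ (phi s)) a.
by rewrite ler_norml; lra.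
Qed.

Let gap_sum s (f : A -> R) :
  `|\sum_a (pi s a - piZ (phi s) a) * f a| <= \sum_a `|f a|.
Proof.
apply: le_trans (ler_norm_sum _ _ _) _; apply: ler_sum => a _.
by rewrite normrM ler_piMl.
Qed.

Let d0 s : (0 <= (d s)%:E)%E. Proof. by rewrite lee_fin distr_ge0. Qed.

Lemma reward_model_error :
  (\esum_(s in [set: S]) (d s)%:E *
     (\sum_a `|reward M s a - RZ (phi s) a|)%:E <=
   #|A|%:R%:E * (chi * J_R M phi doff RZ))%E.
Proof.
pose G s := expect (@unif R A) (fun a => ((reward M s a - RZ (phi s) a) ^+ 2)%:E).
have u0 a : 0 <= @unif R A a by rewrite /unif invr_ge0.
have G0 s : (0 <= G s)%E.
  rewrite /G expect_ge0E//; last by move=> a; rewrite lee_fin sqr_ge0.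
  by apply: esum_ge0 => a _; rewrite mule_ge0 ?lee_fin ?sqr_ge0.
rewrite /J_R expect_ge0E//; last by move=> s; exact: distr_ge0.
apply: le_trans (lee_wpmul2l _ (esum_change_of_measure doffP G0)); last by rewrite lee_fin.
rewrite -esumZ ?lee_fin// => [|s]; last by rewrite mule_ge0 ?sqrte_ge0.
apply: le_esum => s _; rewrite muleCA lee_wpmul2l//.
apply: le_trans (sum_sqrt_le_unif A_gt0 _); last by move=> a; rewrite lee_fin sqr_ge0.
by rewrite -sumEFin; apply: lee_sum => a _ /=; rewrite sqrtr_sqr.
Qed.

(** Pinsker's inequality gives the factor 2 and leaves [2^-1] under the root, where [J_T] has it;
    the sum over actions gives [#|A|]. *)
Lemma transition_model_error :
  (\esum_(s in [set: S]) (d s)%:E *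
     \sum_a \esum_(s' in [set: S]) `|trans M s a s' - PZ (phi s) a s'|%:E <=
   (2 * #|A|%:R)%:E * (chi * J_T M phi doff PZ))%E.
Proof.
pose K s a := D_KL (trans M s a) (PZ (phi s) a).
have K0 s a : (0 <= K s a)%E.
  by apply: D_KL_ge0; rewrite ?distr_sum1// => s'; exact: distr_ge0.
pose G s := (2^-1%:E * expect (@unif R A) (K s))%E.
have u0 a : 0 <= @unif R A a by rewrite /unif invr_ge0.
have E0 s : (0 <= expect (@unif R A) (K s))%E.
  rewrite expect_ge0E//; apply: esum_ge0 => a _; by rewrite mule_ge0 ?lee_fin.
have G0 s : (0 <= G s)%E by rewrite mule_ge0 ?lee_fin.
(* The factor [2^-1] goes inside the mean over states, since the change of measure handles a root at
   each state. *)
have -> : J_T M phi doff PZ = sqrte (\esum_(s in [set: S]) (doff s)%:E * G s)%E.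
  rewrite /J_T expect_ge0E//; last by move=> s; exact: distr_ge0.
  rewrite -esumZ ?lee_fin//; last first.
    by move=> s; apply: mule_ge0; [rewrite lee_fin distr_ge0|exact: E0].
  by congr sqrte; apply: eq_esum => s _; rewrite muleCA.
apply: le_trans (lee_wpmul2l _ (esum_change_of_measure doffP G0)); last by rewrite lee_fin mulr_ge0.
rewrite -esumZ ?lee_fin ?mulr_ge0// => [|s]; last by rewrite mule_ge0 ?sqrte_ge0.
apply: le_esum => s _; rewrite muleCA lee_wpmul2l//.
apply: (@le_trans _ _ (2%:E * \sum_a sqrte (2^-1%:E * K s a))%E).
  rewrite ge0_sume_distrr => [|a _]; last exact: sqrte_ge0.
  apply: lee_sum => a _; apply: pinsker; rewrite ?distr_sum1// => s'; exact: distr_ge0.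
rewrite EFinM -muleA lee_wpmul2l ?lee_fin//.
apply: le_trans (sum_sqrt_le_unif A_gt0 _) _; first by move=> a; rewrite mule_ge0 ?lee_fin.
rewrite le_eqVlt; apply/orP; left; apply/eqP; congr (_ * sqrte _)%E.
rewrite /G !expect_ge0E//; last by move=> a; rewrite mule_ge0 ?lee_fin.
rewrite -esumZ ?lee_fin//; last by move=> a; rewrite mule_ge0 ?lee_fin.
by apply: eq_esum => a _; rewrite muleCA.
Qed.

Lemma PerfDiff_le :
  (PerfDiff M (piZ \o phi) pi <= chi * eps_RT M phi doff RZ PZ +
     (2 * Rmax M / (1 - g) ^+ 2)%:E * sqrte (2^-1%:E * latent_KL M phi pi piZ))%E.
Proof.
have [V [VB VE]] := performance_difference M pi (piZ \o phi).
set B := Rmax M / (1 - g) in VB.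
have B0 : 0 <= B by rewrite divr_ge0// ltW.
(* One-step lookahead in the models, but with the true value function [V]; it depends on the state
   through [phi] alone. *)
pose Q z a := RZ z a + g * mean (PZ z a) V.
have QB z a : `|Q z a| <= B.
  (* [B] solves [x = Rmax + g x], so [Q] obeys the same bound as [V]. *)
  have -> : B = Rmax M + g * B by rewrite /B; field; rewrite gt_eqF.
  rewrite (le_trans (ler_normD _ _))// lerD//; first by rewrite ler_norml RZ_bound.
  by rewrite normrM (ger0_norm g0) ler_wpM2l// ler_norm_mean.
pose T1 s := \sum_a (pi s a - piZ (phi s) a) * (reward M s a - RZ (phi s) a).
pose T2 s := \sum_a (pi s a - piZ (phi s) a) * (mean (trans M s a) V - mean (PZ (phi s) a) V).
pose T3 s := \sum_a (pi s a - piZ (phi s) a) * Q (phi s) a.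
have gap_bounded (f : S -> A -> R) (C : R) : (forall s a, `|f s a| <= C) ->
    fbounded (fun s => \sum_a (pi s a - piZ (phi s) a) * f s a).
  move=> fC; exists (\sum_(a : A) C) => s; apply: le_trans (gap_sum _ _) _.
  by apply: ler_sum => a _.
have b1 : fbounded T1.
  apply: (gap_bounded _ (Rmax M + Rmax M)) => s a.
  by rewrite (le_trans (ler_normB _ _))// lerD ?reward_norm// ler_norml RZ_bound.
have b2 : fbounded T2.
  apply: (gap_bounded _ (B + B)) => s a.
  by rewrite (le_trans (ler_normB _ _))// lerD// ler_norm_mean.
have b3 : fbounded T3 by apply: (gap_bounded _ B) => s a.
have split_adv : (1 - g) * (disc_return M pi (policy_reward M pi) -
    disc_return M (piZ \o phi) (policy_reward M (piZ \o phi))) =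
    mean d T1 + g * mean d T2 + mean d T3.
  rewrite VE -meanZ// -meanD//; last exact: fboundedZ.
  rewrite -meanD//; last by apply: fboundedD => //; exact: fboundedZ.
  congr mean; apply/funext => s; rewrite /T1 /T2 /T3 mulr_sumr -!big_split/=.
  by apply: eq_bigr => a _; rewrite /Q; ring.
have e1 : (`|mean d T1|%:E <= #|A|%:R%:E * (chi * J_R M phi doff RZ))%E.
  apply: le_trans reward_model_error; apply: le_trans (norm_mean_le _ b1) _.
  by apply: le_esum => s _; rewrite lee_wpmul2l// lee_fin gap_sum.
have e2 : (`|mean d T2|%:E <= B%:E * ((2 * #|A|%:R)%:E * (chi * J_T M phi doff PZ)))%E.
  have Bx : (0 <= B%:E)%E by rewrite lee_fin.
  apply: le_trans (lee_wpmul2l Bx transition_model_error).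
  apply: le_trans (norm_mean_le _ b2) _.
  rewrite -esumZ//; last first.
    move=> s; rewrite mule_ge0// sume_ge0// => a _.
    by apply: esum_ge0 => s' _; rewrite lee_fin.
  apply: le_esum => s _; rewrite muleCA lee_wpmul2l//.
  apply: le_trans (_ : (\sum_a `|mean (trans M s a) V - mean (PZ (phi s) a) V|)%:E <= _)%E.
    by rewrite lee_fin gap_sum.
  rewrite -sumEFin ge0_sume_distrr => [|a _]; last first.
    by apply: esum_ge0 => s' _; rewrite lee_fin.
  by apply: lee_sum => a _; exact: norm_meanB_le.
have e3 : (`|mean d T3|%:E <= (2 * B)%:E * sqrte (2^-1%:E * latent_KL M phi pi piZ))%E.
  exact: latent_advantage.
have chi0 : (0 <= chi)%E by rewrite adde_ge0 ?sqrte_ge0.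
have R0 : (0 <= J_R M phi doff RZ)%E by exact: sqrte_ge0.
have T0 : (0 <= J_T M phi doff PZ)%E by exact: sqrte_ge0.
have V0 : 0 <= (1 - g)^-1 by rewrite invr_ge0 ltW.
rewrite /PerfDiff !J_perfE -EFinB /= distrC.
have -> : disc_return M pi (policy_reward M pi) -
    disc_return M (piZ \o phi) (policy_reward M (piZ \o phi)) =
    (1 - g)^-1 * (mean d T1 + g * mean d T2 + mean d T3).
  by rewrite -split_adv mulKf// gt_eqF.
apply: (@le_trans _ _ ((1 - g)^-1%:E * (`|mean d T1|%:E + g%:E * `|mean d T2|%:E + `|mean d T3|%:E))%E).
  have -> : ((1 - g)^-1%:E * (`|mean d T1|%:E + g%:E * `|mean d T2|%:E + `|mean d T3|%:E) =
      ((1 - g)^-1 * (`|mean d T1| + g * `|mean d T2| + `|mean d T3|))%:E)%E.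
    by rewrite EFinM !EFinD EFinM.
  rewrite lee_fin normrM (ger0_norm V0) ler_wpM2l//.
  rewrite (le_trans (ler_normD _ _))// lerD2r (le_trans (ler_normD _ _))// lerD2l.
  by rewrite normrM (ger0_norm g0).
have V0e : (0 <= (1 - g)^-1%:E)%E by rewrite lee_fin.
have g0e : (0 <= g%:E)%E by rewrite lee_fin.
apply: le_trans (lee_wpmul2l V0e (leeD (leeD e1 (lee_wpmul2l g0e e2)) e3)) _.
rewrite /eps_RT le_eqVlt; apply/orP; left; apply/eqP.
(* The losses are generalized to arbitrary nonnegative extended reals: distributivity then rests on
   signs alone, infinite values included, and only real constants remain to be compared. *)
move: (sqrte (2^-1%:E * _))%E (sqrte_ge0 (2^-1%:E * latent_KL M phi pi piZ)%E) => W W0.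
move: (J_R _ _ _ _) (J_T _ _ _ _) (1 + _)%E R0 T0 chi0 => X Y c X0 Y0 c0.
have scale_ge0 (x : R) (y : \bar R) : 0 <= x -> (0 <= y)%E -> (0 <= x%:E * y)%E.
  by move=> x0 y0; rewrite mule_ge0.
have a0 : 0 <= #|A|%:R :> R by [].
have cX : (0 <= c * X)%E by rewrite mule_ge0.
have cY : (0 <= c * Y)%E by rewrite mule_ge0.
have BY : (0 <= g%:E * (B%:E * ((2 * #|A|%:R)%:E * (c * Y))))%E.
  by rewrite scale_ge0// scale_ge0// scale_ge0// mulr_ge0.
rewrite ge0_muleDr; [|by rewrite adde_ge0// scale_ge0|by rewrite scale_ge0// mulr_ge0].
rewrite ge0_muleDr ?scale_ge0//.
rewrite [in RHS]ge0_muleDr; last 2 first.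
- by rewrite scale_ge0// divr_ge0// ltW.
- by rewrite scale_ge0// !mulr_ge0// invr_ge0 exprn_ge0// ltW.
have gn : 1 - g != 0 by rewrite gt_eqF.
congr (_ + _ + _)%E.
- by rewrite [RHS]muleCA [LHS]muleA -EFinM; congr (_%:E * _)%E; rewrite mulrC.
- rewrite [RHS]muleCA 3![LHS]muleA -!EFinM; congr (_%:E * _)%E.
  by rewrite /B; field.
- by rewrite [LHS]muleA -EFinM; congr (_%:E * _)%E; rewrite /B; field.
Qed.

End imitation_bound.

Theorem theorem2 (R : realType) (S Z : choiceType) (A : finType)
    (M : mdp R S A) (pi_star : policy R S A) (phi : S -> Z) :
  (forall (doff : distr R S) (RZ : Z -> A -> R) (PZ : Z -> A -> distr R S),
     (forall s, 0 < visitation M pi_star s -> 0 < doff s) ->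
     (forall z a, - Rmax M <= RZ z a <= Rmax M) ->
     forall piZ : policy R Z A,
       (PerfDiff M (piZ \o phi) pi_star <=
          (1 + sqrte (D_chi2 (visitation M pi_star) doff)) *
            eps_RT M phi doff RZ PZ +
          (2 * Rmax M / (1 - gamma M) ^+ 2)%R%:E *
            sqrte (2^-1%:E * latent_KL M phi pi_star piZ))%E) /\
  (exists const : R, forall piZ : policy R Z A,
     latent_KL M phi pi_star piZ = (const%:E + J_BC M phi pi_star piZ)%E).
Proof.
split; last first.
  by exists (- fine (latent_entropy M phi pi_star)) => piZ; exact: latent_KL_J_BC.
move=> doff RZ PZ doffP RZ_bound piZ; rewrite visitationE in doffP *.
exact: PerfDiff_le.
Qed.
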